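(* Let $\mathfrak{g}=\mathfrak{sl}_2(\mathbb{C})\ltimes V_3$ and let $k\ge 0$. Then $$H^k(\mathfrak{g},\mathfrak{g})\cong\begin{cases}\mathbb{C}, & \text{if } k=1,3,4,6,\\ 0, & \text{otherwise.}\end{cases}$$
   Context: $V_m$ denotes the irreducible $\mathfrak{sl}_2(\mathbb{C})$-module of dimension $m+1$. The semidirect product $\mathfrak{sl}_2(\mathbb{C})\ltimes V_m$ is the vector space $\mathfrak{sl}_2(\mathbb{C})\oplus V_m$ with Lie bracket $[(X,v),(Y,u)]=([X,Y],Xu-Yv)$. $H^k(\mathfrak{g},\mathfrak{g})$ denotes the $k$-th Lie algebra (Chevalley–Eilenberg) cohomology of $\mathfrak{g}$ with coefficients in the adjoint module. *)

(* Defs.v *)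
From HB Require Import structures.
From mathcomp Require Import all_boot all_order all_algebra.
From mathcomp Require Import boolp functions reals.
From mathcomp Require Export complex.

Set Implicit Arguments.
Unset Strict Implicit.
Unset Printing Implicit Defensive.

Import GRing.Theory.
Local Open Scope ring_scope.

HB.mixin Record isLieAlgebra (F : fieldType) L of GRing.Lmodule F L := {
  lie : L -> L -> L;
  lie_linearl : forall y, linear (lie^~ y);
  lie_linearr : forall x, linear (lie x);
  liexx : forall x, lie x x = 0;
  lie_jacobi : forall x y z,
    lie x (lie y z) + lie y (lie z x) + lie z (lie x y) = 0
}.

#[short(type="lieAlgType")]
HB.structure Definition LieAlgebra (F : fieldType) :=
  {L of GRing.Lmodule F L & isLieAlgebra F L}.

HB.mixin Record isLieModule (F : fieldType) (L : lieAlgType F) V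
    of GRing.Lmodule F V := {
  lie_act : L -> V -> V;
  lie_act_linearl : forall v, linear (lie_act^~ v);
  lie_act_linearr : forall x, linear (lie_act x);
  lie_act_lie : forall x y v,
    lie_act (lie x y) v = lie_act x (lie_act y v) - lie_act y (lie_act x v)
}.

#[short(type="lieModType")]
HB.structure Definition LieModule (F : fieldType) (L : lieAlgType F) :=
  {V of GRing.Lmodule F V & isLieModule F L V}.

#[short(type="lieVectType")]
HB.structure Definition LieVector (F : fieldType) (L : lieAlgType F) :=
  {V of Vector F V & isLieModule F L V}.

Definition lie_irreducible (F : fieldType) (L : lieAlgType F)
    (V : lieVectType L) : Prop :=
  fullv != 0%VS :> {vspace V} /\
  forall U : {vspace V},
    (forall (x : L) (u : V), u \in U -> lie_act x u \in U) ->
    U = 0%VS \/ U = fullv.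

Section LieTheory.
Variables (F : fieldType) (L : lieAlgType F).
Implicit Types x y z : L.

Lemma lieDl y : {morph lie^~ y : x z / x + z >-> x + z}.
Proof. by move=> x z; have := lie_linearl y 1 x z; rewrite !scale1r. Qed.

Lemma lieDr x : {morph lie x : y z / y + z >-> y + z}.
Proof. by move=> y z; have := lie_linearr x 1 y z; rewrite !scale1r. Qed.

Lemma lie_anti x y : lie x y = - lie y x.
Proof.
by apply/eqP; rewrite -addr_eq0 -(liexx (x + y)) lieDl !lieDr !liexx add0r addr0.
Qed.

Lemma lieNr x y : lie x (- y) = - lie x y.
Proof.
apply/eqP; rewrite -addr_eq0 -lieDr addNr.
by have := lieDr x 0 0; rewrite addr0 -[LHS]addr0 => /addrI <-.
Qed.

Lemma lie_lie x y z : lie (lie x y) z = lie x (lie y z) - lie y (lie x z).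
Proof.
apply/eqP; rewrite lie_anti eq_sym -subr_eq0 opprK -lieNr -lie_anti.
exact/eqP/lie_jacobi.
Qed.

End LieTheory.

Section ModTheory.
Variables (F : fieldType) (L : lieAlgType F) (V : lieModType L).

Lemma lie_actDr (x : L) : {morph @lie_act F L V x : u v / u + v >-> u + v}.
Proof. by move=> u v; have := lie_act_linearr x 1 u v; rewrite !scale1r. Qed.

Lemma lie_actNr (x : L) (v : V) : lie_act x (- v) = - lie_act x v.
Proof.
apply/eqP; rewrite -addr_eq0 -lie_actDr addNr.
by have := lie_actDr x 0 0; rewrite addr0 -[LHS]addr0 => /addrI <-.
Qed.

Lemma lie_act0r (x : L) : lie_act x (0 : V) = 0.
Proof. by have := lie_actDr x 0 0; rewrite addr0 -[LHS]addr0 => /addrI <-. Qed.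

Lemma lie_actZr (x : L) a (v : V) : lie_act x (a *: v) = a *: lie_act x v.
Proof. by have := lie_act_linearr x a v 0; rewrite lie_act0r !addr0. Qed.

End ModTheory.

Definition ad (F : fieldType) (L : lieAlgType F) : Type := L.

HB.instance Definition _ (F : fieldType) (L : lieAlgType F) :=
  GRing.Lmodule.on (ad L).
HB.instance Definition _ (F : fieldType) (L : lieAlgType F) :=
  isLieModule.Build F L (ad L) (@lie_linearl F L) (@lie_linearr F L)
    (@lie_lie F L).

Fact addr_cancel6 (G : zmodType) (a b c d e f : G) :
  (a - b - (c - d)) + (c - e - (f - b)) + (f - d - (a - e)) = 0.
Proof.
rewrite !opprB [LHS](AC ((2*2)*(2*2)*(2*2))
  ((1*12)*(2*7)*(3*10)*(4*5)*(6*11)*(8*9))).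
by rewrite /= !(subrr, addNr) !addr0.
Qed.

Definition semidirect (F : fieldType) (L : lieAlgType F)
  (V : lieModType L) : Type := (L * V)%type.

Section Semidirect.
Variables (F : fieldType) (L : lieAlgType F) (V : lieModType L).

HB.instance Definition _ := GRing.Lmodule.on (semidirect V).

Definition semidirect_lie (p q : semidirect V) : semidirect V :=
  (lie p.1 q.1, lie_act p.1 q.2 - lie_act q.1 p.2).

Lemma semidirect_linearl q : linear (semidirect_lie^~ q).
Proof.
move=> a p r; congr pair; first exact: lie_linearl.
rewrite /= lie_act_linearl lie_act_linearr.
by rewrite opprD addrACA -scalerBr.
Qed.

Lemma semidirect_linearr p : linear (semidirect_lie p).
Proof.
move=> a q r; congr pair; first exact: lie_linearr.
rewrite /= lie_act_linearl lie_act_linearr.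
by rewrite opprD addrACA -scalerBr.
Qed.

Lemma semidirect_liexx p : semidirect_lie p p = 0.
Proof. by congr pair; [exact: liexx | exact: subrr]. Qed.

Lemma semidirect_jacobi p q r :
  semidirect_lie p (semidirect_lie q r) + semidirect_lie q (semidirect_lie r p)
    + semidirect_lie r (semidirect_lie p q) = 0.
Proof.
congr pair; first exact: lie_jacobi.
rewrite /= !lie_act_lie !lie_actDr !lie_actNr.
exact: addr_cancel6.
Qed.

HB.instance Definition _ := isLieAlgebra.Build F (semidirect V)
  semidirect_linearl semidirect_linearr semidirect_liexx semidirect_jacobi.

End Semidirect.

Definition traceless (F : fieldType) n : pred 'M[F]_n := fun A => \tr A == 0.
Arguments traceless : clear implicits.

Definition sl (F : fieldType) n : Type := {A : 'M[F]_n | traceless F n A}.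

Section Sl.
Variables (F : fieldType) (n : nat).

Lemma traceless_submod : submod_closed (traceless F n).
Proof.
split=> [|a A B]; rewrite ?unfold_in /= /traceless ?mxtrace0 //.
by move=> /eqP trA /eqP trB; rewrite mxtraceD mxtraceZ trA trB mulr0 addr0.
Qed.
HB.instance Definition _ :=
  GRing.isSubmodClosed.Build F 'M[F]_n (traceless F n) traceless_submod.

HB.instance Definition _ := [isSub for (sval : sl F n -> 'M[F]_n)].
HB.instance Definition _ := [Choice of sl F n by <:].
HB.instance Definition _ := [SubChoice_isSubLmodule of sl F n by <:].

Lemma traceless_commutator (A B : 'M[F]_n) :
  traceless F n (A *m B - B *m A).
Proof. by rewrite /traceless linearB /= mxtrace_mulC subrr. Qed.

Definition sl_lie (A B : sl F n) : sl F n :=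
  exist (fun C => traceless F n C) _ (traceless_commutator (val A) (val B)).

Lemma sl_linearl B : linear (sl_lie^~ B).
Proof.
move=> a A A'; apply/val_inj; rewrite /= mulmxDl mulmxDr -scalemxAl -scalemxAr.
by rewrite opprD addrACA -scalerBr.
Qed.

Lemma sl_linearr A : linear (sl_lie A).
Proof.
move=> a B B'; apply/val_inj; rewrite /= mulmxDl mulmxDr -scalemxAl -scalemxAr.
by rewrite opprD addrACA -scalerBr.
Qed.

Lemma sl_liexx A : sl_lie A A = 0.
Proof. by apply/val_inj; rewrite /= subrr. Qed.

Lemma sl_jacobi A B C :
  sl_lie A (sl_lie B C) + sl_lie B (sl_lie C A) + sl_lie C (sl_lie A B) = 0.
Proof.
apply/val_inj; rewrite /= !mulmxBl !mulmxBr !mulmxA.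
exact: addr_cancel6.
Qed.

HB.instance Definition _ := isLieAlgebra.Build F (sl F n)
  sl_linearl sl_linearr sl_liexx sl_jacobi.

End Sl.

(* Over the complex numbers these two conditions determine V_m, up to
   isomorphism. *)
Definition is_V (F : fieldType) (m : nat) (V : lieVectType (sl F 2)) : Prop :=
  lie_irreducible V /\ \dim (fullv : {vspace V}) = m.+1.

(* [submodClosed] does not inherit from [zmodClosed], which [{ideal_quot _}]
   requires; [submod_pred Sc] has both structures. *)
Definition submod_pred (F : fieldType) (V : lmodType F) (S : pred V)
  (Sc : submod_closed S) : {pred V} := S.

HB.instance Definition _ (F : fieldType) (V : lmodType F) (S : pred V)
    (Sc : submod_closed S) :=
  GRing.isSubmodClosed.Build F V (submod_pred Sc) Sc.

Definition quotmod (F : fieldType) (V : lmodType F) (S : pred V)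
  (Sc : submod_closed S) : Type := {ideal_quot (submod_pred Sc)}.

Section QuotMod.
Variables (F : fieldType) (V : lmodType F) (S : pred V).
Variable Sc : submod_closed S.

HB.instance Definition _ := GRing.Zmodule.on (quotmod Sc).

Definition quotmod_pi (v : V) : quotmod Sc :=
  \pi_{ideal_quot (submod_pred Sc)}%qT v.

Definition quotmod_scale (a : F) (q : quotmod Sc) : quotmod Sc :=
  quotmod_pi (a *: repr (q : {ideal_quot (submod_pred Sc)})).

Lemma quotmod_piP u v : (quotmod_pi u = quotmod_pi v) <-> (u - v \in S).
Proof.
rewrite -[u - v \in S]/(u - v \in submod_pred Sc) Quotient.idealrBE.
by split=> /eqP.
Qed.

Lemma quotmod_piD : {morph quotmod_pi : u v / u + v >-> u + v}.
Proof. exact: raddfD. Qed.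

Lemma quotmod_piZ a v : quotmod_pi (a *: v) = quotmod_scale a (quotmod_pi v).
Proof.
apply/quotmod_piP; rewrite -scalerBr; apply: (@rpredZ _ _ (submod_pred Sc)).
by apply/quotmod_piP; rewrite /quotmod_pi reprK.
Qed.

Lemma quotmod_piK (q : quotmod Sc) : quotmod_pi (repr (q : {ideal_quot (submod_pred Sc)})) = q.
Proof. exact: reprK. Qed.

Lemma quotmod_scalerA a b q :
  quotmod_scale a (quotmod_scale b q) = quotmod_scale (a * b) q.
Proof. by rewrite -(quotmod_piK q) -!quotmod_piZ scalerA. Qed.

Lemma quotmod_scale1r : left_id 1 quotmod_scale.
Proof. by move=> q; rewrite -(quotmod_piK q) -!quotmod_piZ scale1r. Qed.

Lemma quotmod_scalerDr : right_distributive quotmod_scale +%R.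
Proof.
move=> a q r; rewrite -(quotmod_piK q) -(quotmod_piK r).
by rewrite -quotmod_piD -!quotmod_piZ scalerDr quotmod_piD.
Qed.

Lemma quotmod_scalerDl q : {morph quotmod_scale^~ q : a b / a + b}.
Proof.
move=> a b; rewrite -(quotmod_piK q).
by rewrite -!quotmod_piZ scalerDl quotmod_piD.
Qed.

HB.instance Definition _ := GRing.Zmodule_isLmodule.Build F (quotmod Sc)
  quotmod_scalerA quotmod_scale1r quotmod_scalerDr quotmod_scalerDl.

End QuotMod.

Section ChevalleyEilenberg.
Variables (F : fieldType) (L : lieAlgType F) (M : lieModType L).

Definition alternating_multilinear k (w : ('I_k -> L) -> M) : Prop :=
  (forall (x : 'I_k -> L) (i : 'I_k),
      linear (fun u : L => w [eta x with i |-> u])) /\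
  (forall (x : 'I_k -> L) (i j : 'I_k), i != j -> x i = x j -> w x = 0).

(* The second sum evaluates w at the k-tuple consisting of [x_i, x_j] followed
   by x_0, ..., x_k with x_i and x_j omitted; the default 0 of [nth] is never
   reached. *)
Definition CE_d k (w : ('I_k -> L) -> M) : ('I_k.+1 -> L) -> M := fun x =>
  \sum_(i < k.+1) (-1) ^+ i *: lie_act (x i) (w (fun l => x (lift i l)))
  + \sum_(i < k.+1) \sum_(j < k.+1 | (i < j)%N)
      (-1) ^+ (i + j)%N *:
        w (fun l => nth 0 (lie (x i) (x j) ::
             [seq x p | p <- enum 'I_k.+1 & (p != i) && (p != j)]) l).

Definition cocycle k : pred (('I_k -> L) -> M) :=
  fun w => `[< alternating_multilinear w /\ CE_d w = 0 >].
Arguments cocycle : clear implicits.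

Definition cocycles k : Type := {w : ('I_k -> L) -> M | cocycle k w}.

Lemma alternating_multilinear_comb k a (w w' : ('I_k -> L) -> M) :
  alternating_multilinear w -> alternating_multilinear w' ->
  alternating_multilinear (a *: w + w').
Proof.
move=> [wL wA] [wL' wA']; split=> [x i b u v|x i j ij xij].
  rewrite !fctE; have /= -> := wL x i b u v; have /= -> := wL' x i b u v.
  by rewrite !scalerDr !scalerA mulrC addrACA.
by rewrite !fctE (wA x i j) // (wA' x i j) // scaler0 addr0.
Qed.

Lemma alternating_multilinear0 k :
  alternating_multilinear (0 : ('I_k -> L) -> M).
Proof. by split=> // x i b u v /=; rewrite scaler0 addr0. Qed.

Lemma CE_d_linear k : linear (@CE_d k).
Proof.
move=> a w w'; apply/funext=> x; rewrite !fctE /CE_d scalerDr addrACA.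
congr (_ + _); rewrite scaler_sumr -big_split /=; apply: eq_bigr => i _.
  by rewrite lie_actDr lie_actZr scalerDr !scalerA mulrC.
rewrite scaler_sumr -big_split /=; apply: eq_bigr => j _.
by rewrite scalerDr !scalerA mulrC.
Qed.

Lemma CE_d0 k : CE_d (0 : ('I_k -> L) -> M) = 0.
Proof.
have /= := CE_d_linear (-1) (0 : ('I_k -> L) -> M) 0.
by rewrite !scaleN1r oppr0 addr0 addNr.
Qed.

Lemma cocycle_submod k : submod_closed (cocycle k).
Proof.
split=> [|a w w']; rewrite ?unfold_in; first apply/asboolP.
  by split; [exact: alternating_multilinear0 | exact: CE_d0].
move=> /asboolP[wA dw] /asboolP[wA' dw']; apply/asboolP; split.
  exact: alternating_multilinear_comb.
by rewrite CE_d_linear dw dw' scaler0 addr0.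
Qed.
HB.instance Definition _ k :=
  GRing.isSubmodClosed.Build F (('I_k -> L) -> M) (cocycle k)
    (cocycle_submod k).

HB.instance Definition _ k :=
  [isSub for (sval : cocycles k -> (('I_k -> L) -> M))].
HB.instance Definition _ k := [Choice of cocycles k by <:].
HB.instance Definition _ k := [SubChoice_isSubLmodule of cocycles k by <:].

Definition is_coboundary k : (('I_k -> L) -> M) -> Prop :=
  match k with
  | 0 => fun w => w = 0
  | k'.+1 => fun w => exists2 v : ('I_k' -> L) -> M,
               alternating_multilinear v & w = CE_d v
  end.

(* As CE_d (CE_d v) = 0, every coboundary is a cocycle, so this is the full
   space of coboundaries, viewed inside [cocycles k]. *)
Definition coboundary k : pred (cocycles k) :=
  fun z => `[< is_coboundary (val z) >].
Arguments coboundary : clear implicits.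

Lemma coboundary_submod k : submod_closed (coboundary k).
Proof.
split=> [|a z z']; rewrite ?unfold_in.
  apply/asboolP; rewrite linear0; case: k => //= k.
  by exists 0; [exact: alternating_multilinear0 | rewrite CE_d0].
move=> /asboolP bz /asboolP bz'; apply/asboolP; rewrite linearP /=.
case: k z z' bz bz' => [|k] z z' /=; first by move=> -> ->; rewrite scaler0 addr0.
move=> [v vA ->] [v' vA' ->]; exists (a *: v + v').
  exact: alternating_multilinear_comb.
by rewrite CE_d_linear.
Qed.

Definition CE_cohomology k : lmodType F := quotmod (@coboundary_submod k).

End ChevalleyEilenberg.

Definition lmod_isomorphic (F : fieldType) (U V : lmodType F) : Prop :=
  exists f : {linear U -> V}, bijective f.

(* Main.v *)
Require Import Defs.
From HB Require Import structures.
From Stdlib Require Import ZArith.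
From mathcomp Require Import all_boot all_order all_algebra.
From mathcomp Require Import boolp functions reals complex ring.
From mathcomp Require Import ssrZ.

Set Implicit Arguments.
Unset Strict Implicit.
Unset Printing Implicit Defensive.

Delimit Scope Z_scope with BZ.

Import Order.TTheory GRing.Theory Num.Theory.
Local Open Scope ring_scope.

(** The computation is the Hochschild-Serre argument, with every chain homotopy
    written down. Let s = sl_2 and g = s + V, and regard a cochain of g with
    values in g as a form on s with values in the s-module N = Hom(Lambda V, g).
    For x in s let i_x be the contraction by x and rho(x) the action of x on N,
    that is, on the arguments in V and on the value. The operator H = i_h rho(h)
    + 2 i_e rho(f) + 2 i_f rho(e) has degree -1, and d H + H d is the action on
    N of the Casimir element h^2 + 2ef + 2fe, whose eigenvalue on V_m is m(m +
    2). Only m <= 7 occurs in N. Hence applying to a cocycle the product of the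
    m(m + 2) - (d H + H d) for m = 1, ..., 7 projects it, up to a coboundary and
    a nonzero factor, onto Lambda s^* (x) N^s.

    If rho is replaced by the action on all the arguments, the same formula
    gives the Casimir operator of the whole complex, by Cartan's formula. On
    Lambda s^* (x) N^s this is the Casimir operator of Lambda s^*, which is 0 in
    degrees 0 and 3 and 8 in degrees 1 and 2; one more factor 8 - (d H + H d)
    leaves only the degrees 0 and 3. As Lambda^p V is V_0, V_3, V_4 + V_0, V_3,
    V_0 for p = 0, ..., 4, and g = V_2 + V_3, the space N^s is spanned by the
    identity of V and by one map Lambda^3 V -> V. Each of the two contributes a
    line in its own degree and another one three degrees higher, by the product
    with the volume form of s; this gives the degrees 1, 3, 4 and 6.

    In a basis of g whose brackets are integral all these operators are sparse
    integral matrices on the 7 * 2^7 coordinates of a cochain, so that it is a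
    finite computation ([checks_lt8]) that the composite projection is the
    expected operator of rank one in the degrees 1, 3, 4, 6 and zero in the
    others. The consequence for cocycles is [cocycle_coords_decomposition].

    Three things connect coordinates with cochains. Cartan's formula d(w)(y, X)
    = (L_y w)(X) - d(i_y w)(X), taken as a recursive definition of d
    ([on_list_CE_d]), computes the coordinates of a differential
    ([coords_CE_list]) and shows that it is alternating. An alternating
    multilinear map is determined by its coordinates ([coords_eq0]), and
    determinants realize arbitrary ones ([coords_cochain_of]). Finally, the
    theory of highest weights produces the standard basis in any irreducible
    module of dimension 4 ([V3_basis]). *)

(** * Cochains as functions of lists *)

Section ListCochains.
Variables (F : fieldType) (L : lieAlgType F) (M : lieModType L).
Implicit Types (W : seq L -> M) (X : seq L) (y : L).

Definition multilin W := forall s t, linear (fun u => W (s ++ u :: t)).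

Definition alternating (T : Type) (V : zmodType) (f : seq T -> V) :=
  (forall s a t, f (s ++ [:: a, a & t]) = 0) /\
  (forall s a b t, f (s ++ [:: a, b & t]) = - f (s ++ [:: b, a & t])).

Lemma multilinD W s t u v : multilin W ->
  W (s ++ (u + v) :: t) = W (s ++ u :: t) + W (s ++ v :: t).
Proof. by move=> mW; have := mW s t 1 u v; rewrite !scale1r. Qed.

Lemma multilin0 W s t : multilin W -> W (s ++ 0 :: t) = 0.
Proof.
move=> mW; have := multilinD s t 0 0 mW.
by rewrite addr0 -[LHS]addr0 => /addrI <-.
Qed.

Lemma multilinZ W s t a u : multilin W ->
  W (s ++ (a *: u) :: t) = a *: W (s ++ u :: t).
Proof.
by move=> mW; have := mW s t a u 0; rewrite addr0 multilin0 // addr0.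
Qed.

(** Expand the value at two adjacent arguments a + b. *)
Lemma alternatingW W : multilin W ->
  (forall s a t, W (s ++ [:: a, a & t]) = 0) -> alternating W.
Proof.
move=> mW aW; split=> // s a b t; apply/eqP; rewrite -addr_eq0.
have := aW s (a + b) t; rewrite multilinD //.
have split2 z : W (s ++ [:: z, a + b & t]) =
    W (s ++ [:: z, a & t]) + W (s ++ [:: z, b & t]).
  by rewrite -!(cat_rcons z); exact: multilinD.
by rewrite !split2 !aW add0r addr0 => ->.
Qed.

Lemma multilin_cons W y : multilin W -> multilin (fun s => W (y :: s)).
Proof. by move=> mW s t; apply: (mW (y :: s) t). Qed.

Lemma alternating_cons (T : Type) (V : zmodType) (f : seq T -> V) (y : T) :
  alternating f -> alternating (fun s => f (y :: s)).
Proof.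
move=> [f0 fN]; split=> [s a t|s a b t]; first exact: (f0 (y :: s)).
exact: (fN (y :: s)).
Qed.

(** The part of the Lie derivative along y that acts on the arguments. *)
Fixpoint arg_act y W X : M :=
  if X is a :: X' then W (lie y a :: X') + arg_act y (fun s => W (a :: s)) X'
  else 0.

Definition lie_der y W X := lie_act y (W X) - arg_act y W X.

(** Cartan's formula i_y d = L_y - d i_y, read as a recursion on the number of
    arguments. This form of the differential needs no signs or omitted
    arguments, so that multilinearity, alternation and the passage to
    coordinates are all proved by induction on lists. *)
Fixpoint CE_list W X : M :=
  if X is y :: X' then lie_der y W X' - CE_list (fun s => W (y :: s)) X'
  else 0.

Lemma lie_act0l (v : M) : lie_act (0 : L) v = 0.
Proof.
have := lie_act_linearl v 1 0 0; rewrite addr0 !scale1r /=.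
by rewrite -[LHS]addr0 => /addrI <-.
Qed.

Lemma linear_combB (a b c d e f : M) (l : F) :
  a = l *: b + c -> d = l *: e + f -> a - d = l *: (b - e) + (c - f).
Proof. by move=> -> ->; rewrite scalerBr opprD addrACA. Qed.

Lemma linear_combD (a b c d e f : M) (l : F) :
  a = l *: b + c -> d = l *: e + f -> a + d = l *: (b + e) + (c + f).
Proof. by move=> -> ->; rewrite scalerDr addrACA. Qed.

Lemma arg_act_linear y a W W' X :
  arg_act y (fun s => a *: W s + W' s) X = a *: arg_act y W X + arg_act y W' X.
Proof.
elim: X W W' => [|x X IH] W W' /=; first by rewrite scaler0 addr0.
exact: linear_combD.
Qed.

Lemma lie_der_linear y a W W' X :
  lie_der y (fun s => a *: W s + W' s) X = a *: lie_der y W X + lie_der y W' X.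
Proof.
by apply: linear_combB; [exact: lie_act_linearr | exact: arg_act_linear].
Qed.

Lemma CE_list_linear a W W' X :
  CE_list (fun s => a *: W s + W' s) X = a *: CE_list W X + CE_list W' X.
Proof.
elim: X W W' => [|x X IH] W W' /=; first by rewrite scaler0 addr0.
by apply: linear_combB; [exact: lie_der_linear | exact: IH].
Qed.

Lemma arg_act_eq0 y W X : (forall s, W s = 0) -> arg_act y W X = 0.
Proof. by elim: X W => //= x X IH W W0; rewrite W0 IH ?addr0. Qed.

Lemma CE_list_eq0 W X : (forall s, W s = 0) -> CE_list W X = 0.
Proof.
elim: X W => //= x X IH W W0.
by rewrite /lie_der W0 IH // arg_act_eq0 // lie_act0r !subr0.
Qed.

Lemma arg_act_linearl W X : multilin W -> linear (fun y => arg_act y W X).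
Proof.
elim: X W => [|x X IH] W mW a u v /=; first by rewrite scaler0 addr0.
apply: linear_combD; last by apply: IH => //; exact: multilin_cons.
by rewrite lie_linearl; exact: (mW [::]).
Qed.

Lemma multilin_arg_act y W : multilin W -> multilin (arg_act y W).
Proof.
move=> mW s; elim: s W mW => [|x s IH] W mW t a u v /=.
  apply: linear_combD; first by rewrite lie_linearr; exact: (mW [::]).
  rewrite -arg_act_linear; congr (arg_act y _ _).
  by apply/funext => r; exact: (mW [::]).
apply: linear_combD; first exact: (mW (_ :: _)).
by apply: IH; exact: multilin_cons.
Qed.

Lemma multilin_lie_der y W : multilin W -> multilin (lie_der y W).
Proof.
move=> mW s t a u v; apply: linear_combB; last exact: multilin_arg_act.
by rewrite mW; exact: lie_act_linearr.
Qed.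

Lemma multilin_CE_list W : multilin W -> multilin (CE_list W).
Proof.
move=> mW s; elim: s W mW => [|x s IH] W mW t a u v /=; apply: linear_combB.
- apply: linear_combB; first exact: lie_act_linearl.
  exact: arg_act_linearl.
- rewrite -CE_list_linear; congr (CE_list _ _).
  by apply/funext => r; exact: (mW [::]).
- exact: multilin_lie_der.
by apply: IH; exact: multilin_cons.
Qed.

Lemma arg_act_rep y W s a t : alternating W ->
  arg_act y W (s ++ [:: a, a & t]) = 0.
Proof.
move=> aW; elim: s W aW => [|x s IH] W aW /=.
  have [W0 WN] := aW.
  rewrite (WN [::]) /= addKr.
  by apply: arg_act_eq0 => r; exact: (W0 [::]).
rewrite (proj1 aW (_ :: _)) IH ?addr0 //.
exact: alternating_cons.
Qed.

Lemma lie_der_rep y W s a t : alternating W ->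
  lie_der y W (s ++ [:: a, a & t]) = 0.
Proof.
by move=> aW; rewrite /lie_der arg_act_rep // (proj1 aW) lie_act0r subr0.
Qed.

(** When the repeated argument a comes first, the formula gives L_a i_a W twice
    with opposite signs, and i_a i_a W = 0; otherwise L_x W and i_x W are again
    alternating. *)
Lemma alternating_CE_list W : multilin W -> alternating W ->
  alternating (CE_list W).
Proof.
move=> mW aW; apply: alternatingW; first exact: multilin_CE_list.
move=> s a t; elim: s W mW aW => [|x s IH] W mW aW /=.
  rewrite /lie_der /= liexx (multilin0 [::]) // add0r.
  rewrite [X in _ - (_ - X)]CE_list_eq0 => [|r]; last exact: (proj1 aW [::]).
  by rewrite subr0 subrr.
rewrite lie_der_rep // IH ?subr0 //; first exact: multilin_cons.
exact: alternating_cons.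
Qed.

Definition del_nth (T : Type) i (s : seq T) := take i s ++ drop i.+1 s.

(** The usual formula for the differential, over all lengths at once. *)
Definition CE_sum W X : M :=
  \sum_(i < size X) (-1) ^+ i *: lie_act X`_i (W (del_nth i X))
  + \sum_(i < size X) \sum_(j < size X | (i < j)%N)
      (-1) ^+ (i + j)%N *: W (lie X`_i X`_j :: del_nth i (del_nth j X)).

(** Moving [y, X_j] to the front of the arguments costs the sign (-1)^j. *)
Lemma arg_act_sum y W X : alternating W ->
  arg_act y W X = \sum_(j < size X) (-1) ^+ j *: W (lie y X`_j :: del_nth j X).
Proof.
elim: X W => [|x X IH] W aW /=; first by rewrite big_ord0.
rewrite big_ord_recl expr0 scale1r /= /del_nth /= drop0; congr (_ + _).
rewrite IH; last exact: alternating_cons.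
apply: eq_bigr => j _; rewrite /bump /= add1n exprS mulN1r scaleNr.
by rewrite (proj2 aW [::]) scalerN.
Qed.

Lemma sum_lt_recl n (f : nat -> nat -> M) :
  \sum_(i < n.+1) \sum_(j < n.+1 | (i < j)%N) f i j =
  \sum_(j < n) f 0%N j.+1 + \sum_(i < n) \sum_(j < n | (i < j)%N) f i.+1 j.+1.
Proof.
have recl i : \sum_(j < n.+1 | (i < j)%N) f i j =
    \sum_(j < n | (i < j.+1)%N) f i j.+1.
  by rewrite big_mkcond big_ord_recl /= add0r -big_mkcond.
rewrite big_ord_recl recl; congr (_ + _); apply: eq_bigr => i _.
by rewrite recl.
Qed.

(** The terms of the usual formula that involve the first argument y make up L_y
    W; the others are those of i_y W with the opposite sign, which comes from
    the index shift in the first sum and from the exchange of y with [X_i, X_j]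
    in the second. *)
Lemma CE_sum_cons y W X : alternating W ->
  CE_sum W (y :: X) = lie_der y W X - CE_sum (fun s => W (y :: s)) X.
Proof.
move=> aW; rewrite /CE_sum /= big_ord_recl.
rewrite (sum_lt_recl _ (fun i j => (-1) ^+ (i + j)%N *:
  W (lie (y :: X)`_i (y :: X)`_j :: del_nth i (del_nth j (y :: X))))).
rewrite expr0 scale1r /lie_der arg_act_sum // opprD.
have -> : del_nth 0 (y :: X) = X by rewrite /del_nth /= drop0.
rewrite -!addrA; congr (_ + _); rewrite addrCA.
congr (_ + _); last congr (_ + _).
- rewrite -sumrN; apply: eq_bigr => j _; rewrite add0n exprS mulN1r scaleNr.
  by rewrite /del_nth /= !drop0.
- rewrite -sumrN; apply: eq_bigr => j _ /=.
  by rewrite /bump leq0n add1n exprS mulN1r scaleNr.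
rewrite -sumrN; apply: eq_bigr => i _; rewrite -sumrN; apply: eq_bigr => j _.
by rewrite addSn addnS !exprS !mulN1r opprK /= (proj2 aW [::]) scalerN.
Qed.

Lemma CE_sumE W X : alternating W -> CE_sum W X = CE_list W X.
Proof.
elim: X W => [|y X IH] W aW; first by rewrite /CE_sum /= !big_ord0 addr0.
by rewrite CE_sum_cons // IH //; exact: alternating_cons.
Qed.

(** The value 0 on lists of the wrong length makes [on_list] compatible with the
    differential in all lengths. *)
Definition on_list k (w : ('I_k -> L) -> M) : seq L -> M :=
  fun s => if size s == k then w (fun i => s`_i) else 0.

Lemma multilin_on_list k (w : ('I_k -> L) -> M) :
  alternating_multilinear w -> multilin (on_list w).
Proof.
case=> wL _ s t a u v; rewrite /on_list !size_cat /= addnS -addSn.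
case: eqP => [sz|]; last by rewrite scaler0 addr0.
have ltk : (size s < k)%N by rewrite -sz leq_addr.
have slot z : (fun i : 'I_k => (s ++ z :: t)`_i) =
    [eta (fun i : 'I_k => (s ++ 0 :: t)`_i) with Ordinal ltk |-> z].
  apply/funext => i /=; rewrite -val_eqE /= !nth_cat.
  case: ltngtP => // [lti|->]; last by rewrite subnn.
  by rewrite -(subnSK lti).
by rewrite (slot (a *: u + v)) (slot u) (slot v); exact: wL.
Qed.

Lemma alternating_on_list k (w : ('I_k -> L) -> M) :
  alternating_multilinear w -> alternating (on_list w).
Proof.
move=> aw; apply: alternatingW; first exact: multilin_on_list.
case: aw => _ wA s a t; rewrite /on_list !size_cat /= !addnS.
case: eqP => // sz.
have lt1 : (size s < k)%N by rewrite -sz ltnS leqW // leq_addr.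
have lt2 : ((size s).+1 < k)%N by rewrite -sz !ltnS leq_addr.
apply: (wA _ (Ordinal lt1) (Ordinal lt2)).
  by rewrite -val_eqE /= -{1}[size s]addn0 -addn1 eqn_add2l.
by rewrite /= !nth_cat ltnn subnn ltnNge leqnSn /= subSnn.
Qed.

Lemma nth_del_nth (T : Type) (x0 : T) s i j :
  nth x0 (del_nth i s) j = nth x0 s (bump i j).
Proof.
elim: s i j => [|x s IH] [|i] [|j] //=; rewrite ?nth_nil //.
- by rewrite /del_nth /= drop0.
- by rewrite /del_nth /= drop0.
by have := IH i j; rewrite /del_nth /= => ->; rewrite bumpS.
Qed.

Lemma size_del_nth (T : Type) (s : seq T) i : (i < size s)%N ->
  size (del_nth i s) = (size s).-1.
Proof.
move=> lti; rewrite size_cat size_take lti size_drop -{2}(subnKC lti).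
by rewrite addSn.
Qed.

Lemma del_nth_filter (T : Type) (x0 : T) (s : seq T) i j : (i < j)%N ->
  [seq nth x0 s p | p <- iota 0 (size s) & (p != i) && (p != j)] =
  del_nth i (del_nth j s).
Proof.
have del1 (r : seq T) q :
    [seq nth x0 r p | p <- iota 0 (size r) & p != q] = del_nth q r.
  elim: r q => [|x r IH] [|q] //=.
    rewrite /del_nth /= drop0 -[1%N]/(1 + 0)%N iotaDl filter_map -map_comp /=.
    rewrite (eq_filter (a2 := predT)) // filter_predT.
    by rewrite (map_nth_iota0 x0) ?take_size // leqnn.
  rewrite /del_nth /= -/(del_nth q r) -IH -[1%N]/(1 + 0)%N iotaDl filter_map.
  by rewrite -map_comp.
elim: s i j => [|x s IH] [|i] [|j] //= ij.
  rewrite -[1%N]/(1 + 0)%N iotaDl filter_map -map_comp /= /del_nth /= drop0.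
  by rewrite -/(del_nth j s) -del1.
rewrite /del_nth /= -/(del_nth j s) -/(del_nth i (del_nth j s)) -IH //.
rewrite -[1%N]/(1 + 0)%N.
by rewrite iotaDl filter_map -map_comp.
Qed.

Lemma on_list_CE_d k (w : ('I_k -> L) -> M) : alternating_multilinear w ->
  on_list (CE_d w) = CE_list (on_list w).
Proof.
move=> aw; apply/funext => X; rewrite -CE_sumE; last exact: alternating_on_list.
rewrite {1}/on_list; case: eqP => [sz|/eqP sz]; last first.
  have szN n : size X = n.+1 -> (n == k) = false.
    by move=> e; apply/negbTE; rewrite -eqSS -e.
  rewrite /CE_sum [X in X + _]big1 => [|i _]; last first.
    rewrite /on_list size_del_nth // szN ?lie_act0r ?scaler0 //.
    by rewrite prednK // (leq_ltn_trans _ (ltn_ord i)).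
  rewrite add0r big1 // => i _; rewrite big1 // => j ij.
  have lti : (i < (size X).-1)%N.
    by rewrite (leq_trans ij) // -ltnS (ltn_predK (ltn_ord j)).
  rewrite /on_list /= !size_del_nth ?size_del_nth // (ltn_predK lti).
  by rewrite szN ?scaler0 // (ltn_predK (ltn_ord j)).
rewrite /CE_d /CE_sum sz; congr (_ + _).
  apply: eq_bigr => i _; congr (_ *: lie_act _ _).
  rewrite /on_list size_del_nth ?sz // eqxx; congr w.
  by apply/funext => l; rewrite nth_del_nth.
apply: eq_bigr => i _; apply: eq_bigr => j ij; congr (_ *: _).
have szj : size (del_nth j X) = k by rewrite size_del_nth sz.
have ltik : (i < k)%N by rewrite (leq_trans ij) // -ltnS.
rewrite /on_list /= size_del_nth szj // (ltn_predK ltik) eqxx; congr w.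
apply/funext => l; congr (nth _ (_ :: _) _).
rewrite -(del_nth_filter 0 X ij) sz -val_enum_ord.
rewrite [RHS](congr1 _ (filter_map _ _ _)) -map_comp.
by congr (map _ _); apply: eq_filter => p.
Qed.

End ListCochains.

Section Combinations.
Variables (F : fieldType) (L : lieAlgType F) (M : lieModType L).
Implicit Types (W : seq L -> M).

Lemma multilin_comb a W W' : multilin W -> multilin W' ->
  multilin (fun s => a *: W s + W' s).
Proof.
move=> mW mW' s t c u v; rewrite mW mW' !scalerDr !scalerA mulrC.
by rewrite addrACA.
Qed.

Lemma alternating_comb (T : Type) (V : lmodType F) a (f g : seq T -> V) :
  alternating f -> alternating g -> alternating (fun s => a *: f s + g s).
Proof.
move=> [f0 fN] [g0 gN]; split=> [s x t|s x y t].
  by rewrite f0 g0 scaler0 addr0.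
by rewrite fN gN scalerN opprD.
Qed.

Lemma on_list_codom k (w : ('I_k -> L) -> M) x :
  on_list w [seq x i | i <- enum 'I_k] = w x.
Proof.
rewrite /on_list size_map size_enum_ord eqxx; congr w; apply/funext => i.
by rewrite (nth_map i) ?size_enum_ord // nth_ord_enum.
Qed.

End Combinations.

(** * Integral linear forms in the coordinates of a cochain *)

(** The pair of a list s and an index c stands for the c-th coordinate of the
    value of a cochain at the basis vectors listed in s. *)
Definition key := (seq nat * nat)%type.
Definition form := seq (Z * key).

(** The sign is 0 when a already occurs in the sorted list s. *)
Fixpoint insert_sign (a : nat) (s : seq nat) : Z * seq nat :=
  if s is b :: s' then
    if (a < b)%N then (1%BZ, a :: s) else
    if a == b then (0%BZ, s) else
    let: (n, t) := insert_sign a s' in (Z.opp n, b :: t)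
  else (1%BZ, [:: a]).

Fixpoint sort_sign (s : seq nat) : Z * seq nat :=
  if s is a :: s' then
    let: (n, t) := sort_sign s' in
    let: (m, u) := insert_sign a t in (Z.mul n m, u)
  else (1%BZ, [::]).

Definition scale_form (n : Z) (l : form) : form :=
  [seq (Z.mul n t.1, t.2) | t <- l].

Definition subst_form (A : key -> form) (l : form) : form :=
  flatten [seq scale_form t.1 (A t.2) | t <- l].

Fixpoint add_term (n : Z) (b : key) (l : form) : form :=
  if l is (m, b') :: l' then
    if b == b' then (Z.add n m, b') :: l' else (m, b') :: add_term n b l'
  else [:: (n, b)].

Definition collect (l : form) : form :=
  [seq t <- foldr (fun t r => if Z.eqb t.1 0 then r else add_term t.1 t.2 r)
                  [::] l | ~~ Z.eqb t.1 0].

(** Having no term left is sufficient for a form to be zero as a function. *)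
Definition vanishes (l : form) : bool := nilp (collect l).

(** This preserves the value of a form at alternating functions only; compare
    [eval_collect] and [eval_straighten]. *)
Definition straighten (l : form) : form :=
  [seq let: (n, u) := sort_sign t.2.1 in (Z.mul t.1 n, (u, t.2.2)) | t <- l].

Section Eval.
Variable F : fieldType.

Definition Zr (n : Z) : F := (int_of_Z n)%:~R.

Lemma Zr1 : Zr 1 = 1. Proof. by []. Qed.

Lemma ZrD m n : Zr (Z.add m n) = Zr m + Zr n.
Proof. by rewrite /Zr -[Z.add m n]/(m + n) !rmorphD. Qed.

Lemma ZrM m n : Zr (Z.mul m n) = Zr m * Zr n.
Proof. by rewrite /Zr -[Z.mul m n]/(m * n) !rmorphM. Qed.

Lemma ZrN n : Zr (Z.opp n) = - Zr n.
Proof. by rewrite /Zr -[Z.opp n]/(- n) !rmorphN. Qed.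

Lemma Zr_div4 n : Z.modulo n 4 = 0%BZ -> Zr n = Zr (Z.div n 4) * 4.
Proof.
move=> n4; rewrite {1}(Z.div_mod n 4) // n4 Z.add_0_r ZrM mulrC.
by congr (_ * _).
Qed.

Lemma sort_sign_scale (V : lmodType F) (g : seq nat -> V) s : alternating g ->
  g s = Zr (sort_sign s).1 *: g (sort_sign s).2.
Proof.
have insertE a r (h : seq nat -> V) : alternating h ->
    h (a :: r) = Zr (insert_sign a r).1 *: h (insert_sign a r).2.
  elim: r h => [|b r IH] h ah /=; first by rewrite scale1r.
  case: ltngtP => [_|_|<-] /=; rewrite ?scale1r //; last first.
    by rewrite scale0r; apply: (proj1 ah [::]).
  rewrite [LHS](proj2 ah [::]) /= (IH (fun r => h (b :: r))).
    by case: (insert_sign a r) => n t /=; rewrite ZrN scaleNr.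
  exact: alternating_cons.
elim: s g => [|a s IH] g ag /=; first by rewrite scale1r.
rewrite (IH (fun r => g (a :: r))); last exact: alternating_cons.
case: (sort_sign s) => n t /=; rewrite (insertE _ _ _ ag).
by case: (insert_sign a t) => m u /=; rewrite ZrM scalerA.
Qed.

Implicit Types (f g : key -> F) (l : form) (b : key).

Definition eval f l : F := \sum_(t <- l) Zr t.1 * f t.2.

(** A family of forms, one for each coordinate, is the list of rows of a matrix;
    this is the operator of that matrix. *)
Definition op (A : key -> form) f b : F := eval f (A b).

Lemma eval_cons f t l : eval f (t :: l) = Zr t.1 * f t.2 + eval f l.
Proof. by rewrite /eval big_cons. Qed.

Lemma eval_cat f l l' : eval f (l ++ l') = eval f l + eval f l'.
Proof. by rewrite /eval big_cat. Qed.

Lemma eval_scale_form f n l : eval f (scale_form n l) = Zr n * eval f l.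
Proof.
by rewrite /eval big_map mulr_sumr; apply: eq_bigr => t _; rewrite ZrM mulrA.
Qed.

Lemma eval_oppr_form f l : eval f (scale_form (-1)%BZ l) = - eval f l.
Proof. by rewrite eval_scale_form (ZrN 1) Zr1 mulN1r. Qed.

Lemma eval_subst_form f A l : eval f (subst_form A l) = eval (op A f) l.
Proof.
rewrite /subst_form; elim: l => [|t l IH]; first by rewrite /eval !big_nil.
by rewrite /= eval_cat eval_scale_form eval_cons IH.
Qed.

Lemma eq_eval f g l : {in [seq t.2 | t <- l], f =1 g} -> eval f l = eval g l.
Proof.
move=> fg; rewrite /eval !big_seq; apply: eq_bigr => t tl.
by rewrite fg // map_f.
Qed.

Lemma eval_linear a f g l :
  eval (fun b => a * f b + g b) l = a * eval f l + eval g l.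
Proof.
rewrite /eval mulr_sumr -big_split /=; apply: eq_bigr => t _.
by rewrite mulrDr mulrCA.
Qed.

Lemma eval_collect f l : eval f (collect l) = eval f l.
Proof.
have eval_filter r : eval f [seq t <- r | ~~ Z.eqb t.1 0] = eval f r.
  rewrite /eval big_filter [RHS](bigID (fun t => ~~ Z.eqb t.1 0)) /=.
  rewrite [X in _ + X]big1 ?addr0 // => t; rewrite negbK.
  by move/Z.eqb_spec => ->; rewrite mul0r.
have eval_add n b r : eval f (add_term n b r) = Zr n * f b + eval f r.
  elim: r => [|[m b'] r IH] /=; first by rewrite eval_cons.
  case: eqP => [->|_]; rewrite !eval_cons /=; first by rewrite ZrD mulrDl addrA.
  by rewrite IH addrCA.
rewrite /collect eval_filter; elim: l => //= t l IH; rewrite eval_cons.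
case: (Z.eqb_spec t.1 0) => [->|_]; first by rewrite mul0r add0r.
by rewrite eval_add IH.
Qed.

Lemma eval_straighten f l : (forall c, alternating (fun s => f (s, c))) ->
  eval f (straighten l) = eval f l.
Proof.
move=> af; rewrite /eval big_map; apply: eq_bigr => -[n [s c]] _ /=.
have := @sort_sign_scale F^o (fun s => f (s, c)) s (af c).
by case: (sort_sign s) => m u /= ->; rewrite ZrM mulrA.
Qed.

Lemma eval_vanishes f l : vanishes l -> eval f l = 0.
Proof.
by rewrite /vanishes -eval_collect => /nilP ->; rewrite /eval big_nil.
Qed.

End Eval.

Lemma sorted_insert_sign a s : sorted ltn s -> sorted ltn (insert_sign a s).2.
Proof.
suff ins b r : path ltn b r -> (b < a)%N -> path ltn b (insert_sign a r).2.
  case: s => //= b r br; case: ltngtP => [ab|ba|_] //=; first by rewrite ab.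
  by have := ins _ _ br ba; case: insert_sign.
elim: r b => [|c r IH] b /=; first by move=> _ ->.
move=> /andP[bc cr] ba; case: ltngtP => [ac|ca|ac] /=; rewrite ?ba ?ac ?bc //.
by have := IH _ cr ca; case: insert_sign => /= n t ->; rewrite bc.
Qed.

Lemma sorted_sort_sign s : sorted ltn (sort_sign s).2.
Proof.
elim: s => //= a s; case: (sort_sign s) => n t /= st.
by have := sorted_insert_sign a st; case: insert_sign.
Qed.

Lemma all_sort_sign (p : pred nat) s : all p s -> all p (sort_sign s).2.
Proof.
have ins a r : p a -> all p r -> all p (insert_sign a r).2.
  move=> pa; elim: r => [|b r IH] /=; first by rewrite pa.
  move=> /andP[pb pr]; case: ltngtP => _ /=; rewrite ?pa ?pb //.
  by have := IH pr; case: insert_sign => n t /= ->; rewrite pb.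
elim: s => //= a s IH /andP[pa /IH]; case: (sort_sign s) => n t /= pt.
by have := ins _ _ pa pt; case: insert_sign.
Qed.

(** * The complex in coordinates *)

(* In ring_scope the literals below would be sums of units of a ring, which are
   costly to compute with. *)
Local Close Scope ring_scope.

(** The structure constants of g in the basis e, h, f, v_0, ..., v_3, numbered
    from 0 to 6, where f v_i = v_(i+1) and e v_i = i (4 - i) v_(i-1). The
    bracket of two basis vectors is a multiple of a basis vector: the entry (n,
    c) stands for n times the c-th one. Two of the v_i commute, which is covered
    by the default value. *)
Definition bracket (a b : nat) : Z * nat :=
  nth (0%BZ, 0%N) (nth [::]
  [:: [:: (0%BZ, 0); ((-2)%BZ, 0); (1%BZ, 1);
          (0%BZ, 3); (3%BZ, 3); (4%BZ, 4); (3%BZ, 5)];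
      [:: (2%BZ, 0); (0%BZ, 0); ((-2)%BZ, 2);
          (3%BZ, 3); (1%BZ, 4); ((-1)%BZ, 5); ((-3)%BZ, 6)];
      [:: ((-1)%BZ, 1); (2%BZ, 2); (0%BZ, 0);
          (1%BZ, 4); (1%BZ, 5); (1%BZ, 6); (0%BZ, 6)];
      [:: (0%BZ, 3); ((-3)%BZ, 3); ((-1)%BZ, 4)];
      [:: ((-3)%BZ, 3); ((-1)%BZ, 4); ((-1)%BZ, 5)];
      [:: ((-4)%BZ, 4); (1%BZ, 5); ((-1)%BZ, 6)];
      [:: ((-3)%BZ, 5); (3%BZ, 6); (0%BZ, 6)]] a) b.

(** The dual of the contraction by the a-th basis vector. *)
Definition prepend (a : nat) (l : form) : form :=
  [seq (t.1, (a :: t.2.1, t.2.2)) | t <- l].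

Definition on_g : pred nat := fun _ => true.

Definition on_V : pred nat := fun a => (2 < a)%N.

(** The coordinates at s and c of the action of the y-th basis vector on the
    arguments that satisfy P; compare [arg_act]. *)
Fixpoint arg_terms (P : pred nat) (y : nat) (s : seq nat) (c : nat) : form :=
  if s is a :: s' then
    let l := prepend a (arg_terms P y s' c) in
    if P a then ((bracket y a).1, ((bracket y a).2 :: s', c)) :: l else l
  else [::].

Definition val_terms (y : nat) (s : seq nat) (c : nat) : form :=
  [seq ((bracket y a).1, (s, a)) | a <- iota 0 7 & (bracket y a).2 == c].

Definition act_terms P y s c : form :=
  val_terms y s c ++ scale_form (-1)%BZ (arg_terms P y s c).

(** Cartan's recursion of [CE_list], in coordinates. *)
Fixpoint CE_terms (s : seq nat) (c : nat) : form :=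
  if s is y :: s' then
    act_terms on_g y s' c ++ scale_form (-1)%BZ (prepend y (CE_terms s' c))
  else [::].

Definition CE_form (b : key) : form := collect (straighten (CE_terms b.1 b.2)).

(** The operator i_h rho(h) + 2 i_e rho(f) + 2 i_f rho(e), where rho is the
    action on the value and on the arguments that satisfy P: the Casimir element
    h^2 + 2ef + 2fe with the left factor of each product turned into a
    contraction. *)
Definition homotopy (P : pred nat) (b : key) : form :=
  collect (straighten (act_terms P 1 (1 :: b.1) b.2
    ++ scale_form 2%BZ (act_terms P 2 (0 :: b.1) b.2)
    ++ scale_form 2%BZ (act_terms P 0 (2 :: b.1) b.2))).

(** Defined as d H + H d, so that the Casimir operators are null-homotopic by
    construction. For [on_V] it acts on Hom(Lambda V, g), for [on_g] on the
    whole complex. *)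
Definition casimir P (b : key) : form :=
  collect (subst_form CE_form (homotopy P b)
    ++ subst_form (homotopy P) (CE_form b)).

(** The rows of c - A, composed with the form l. *)
Definition scalar_minus (A : key -> form) (c : Z) (l : form) : form :=
  collect (scale_form c l ++ scale_form (-1)%BZ (subst_form A l)).

(** The eigenvalues m (m + 2) of the Casimir element on V_1, ..., V_7; the
    largest module V_7 occurs in Hom(Lambda^2 V, V). *)
Definition eigenvalues : seq Z := [:: 3; 8; 15; 24; 35; 48; 63]%BZ.

(** The operator applied first is the outermost one, since forms compose in the
    opposite order: first the Casimir operator A is projected away from its
    nonzero eigenvalues, then the factor 8 - B removes Lambda^1 s^* and Lambda^2
    s^*. *)
Definition invariant_projection (A B : key -> form) (b : key) : form :=
  foldr (scalar_minus A) (scalar_minus B 8%BZ [:: (1%BZ, b)]) eigenvalues.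

Definition normalizer : Z := foldr Z.mul 8%BZ eigenvalues.

Fixpoint sublists (s : seq nat) : seq (seq nat) :=
  if s is a :: s' then
    let t := sublists s' in [seq a :: u | u <- t] ++ t
  else [:: [::]].

Definition supports k := [seq s <- sublists (iota 0 7) | size s == k].

Definition keys k : seq key := [seq (s, c) | s <- supports k, c <- iota 0 7].

(** The support of the invariant cochain of degree k, whose coordinates there
    are all equal to 1: the identity of V in degree 1, the invariant map
    Lambda^3 V -> V in degree 3, and their products with the volume form of
    sl_2. *)
Definition invariant_keys (k : nat) : seq key :=
  let id := [:: ([:: 3], 3); ([:: 4], 4); ([:: 5], 5); ([:: 6], 6)] in
  let cube := [:: ([:: 3; 4; 5], 3); ([:: 3; 4; 6], 4);
                  ([:: 3; 5; 6], 5); ([:: 4; 5; 6], 6)] in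
  let vol := map (fun b : key => ([:: 0, 1, 2 & b.1], b.2)) in
  match k with
  | 1 => id | 3 => cube | 4 => vol id | 6 => vol cube | _ => [::]
  end%N.

(** * Verification of the integral identities *)

Fixpoint find_row (t : seq (seq nat * seq form)) (s : seq nat) : seq form :=
  if t is (s', r) :: t' then if s == s' then r else find_row t' s else [::].

(** A itself ([memoE]), with the rows at the lists in ss tabulated, so that
    repeated use does not recompute them. *)
Definition memo (A : key -> form) (ss : seq (seq nat)) : key -> form :=
  let t := [seq (s, [seq A (s, c) | c <- iota 0 7]) | s <- ss] in
  fun b => if onth (find_row t b.1) b.2 is Some r then r else A b.

Definition coef_sum (p : pred key) (l : form) : Z :=
  foldr (fun t n => if p t.2 then Z.add t.1 n else n) 0%BZ l.

Definition homogeneous (A : key -> form) (k l : nat) : bool :=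
  let ls := keys l in all (fun b => all (fun t => t.2 \in ls) (A b)) (keys k).

Definition square_zero_check (k : nat) : bool :=
  all (fun b => vanishes (subst_form CE_form (CE_form b))) (keys k).

(** The expected row of the projection: at each b of the support, the normalizer
    times the mean of the four coordinates in the support. *)
Definition rank_one (k : nat) (b : key) : form :=
  if b \in invariant_keys k
  then [seq (Z.div normalizer 4, b') | b' <- invariant_keys k] else [::].

Definition projection_check (k : nat) : bool :=
  let A := memo (casimir on_V) (supports k) in
  let B := memo (casimir on_g) (supports k) in
  all (fun b => vanishes (invariant_projection A B b
                          ++ scale_form (-1)%BZ (rank_one k b))) (keys k).

(** The sum over the coordinates of the invariant class kills coboundaries, and
    the invariant class is a cocycle. *)
Definition pairing_check (k : nat) : bool :=
  vanishes (subst_form CE_form [seq (1%BZ, b) | b <- invariant_keys k]) &&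
  all (fun b => Z.eqb (coef_sum (mem (invariant_keys k.-1)) (CE_form b)) 0)
    (keys k).

Definition checks (k : nat) : bool :=
  [&& homogeneous CE_form k k.-1, homogeneous (homotopy on_g) k k.+1,
      homogeneous (homotopy on_V) k k.+1, square_zero_check k &
  [&& projection_check k, pairing_check k &
      all (fun b => b \in keys k) (invariant_keys k)]].

Lemma memoE A ss : memo A ss = A.
Proof.
apply/funext => -[s c]; rewrite /memo /=; elim: ss => [|s' ss IH] //=.
  by case: c.
case: (eqVneq s s') => [<-|_]; last exact: IH.
move: c {IH} => c.
by do 7?[case: c => [//|c]]; case: c.
Qed.

Lemma checks_lt8 : all checks (iota 0 8).
Proof. by vm_compute. Qed.

Local Open Scope ring_scope.

Lemma mem_sublists s t : (s \in sublists t) = subseq s t.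
Proof.
elim: t s => [|y t IH] [|x s] //=; first by rewrite mem_cat IH sub0seq orbT.
rewrite mem_cat IH; case: eqP => [<-|xy].
  rewrite mem_map; last by move=> ? ? [].
  by rewrite IH; apply/orb_idr/subseq_trans/subseq_cons.
by apply/orb_idl => /mapP[u _ [/xy]].
Qed.

Lemma subseq_iota s n : subseq s (iota 0 n) = sorted ltn s && all (gtn n) s.
Proof.
apply/idP/andP => [sub|[sorted_s lt_s]].
  split; first exact: subseq_sorted ltn_trans _ _ sub (iota_ltn_sorted 0 n).
  by apply/allP => i /(mem_subseq sub); rewrite mem_iota.
rewrite (_ : s = [seq i <- iota 0 n | i \in s]) ?filter_subseq //.
apply: (irr_sorted_eq ltn_trans ltnn) => //.
  exact: sorted_filter ltn_trans _ _ (iota_ltn_sorted 0 n).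
move=> i; rewrite mem_filter mem_iota /=; apply/esym/andb_idr.
by move=> /(allP lt_s).
Qed.

Lemma mem_keys k s c : ((s, c) \in keys k) =
  [&& sorted ltn s, all (gtn 7) s, size s == k & (c < 7)%N].
Proof.
rewrite /keys /supports; apply/allpairsP/and4P => [[[s' c']]|].
  rewrite mem_filter mem_sublists subseq_iota mem_iota /=.
  by case=> + + [-> ->] => /andP[-> /andP[-> ->]] ->.
case=> sorted_s lt_s sz ltc; exists (s, c).
by rewrite mem_filter sz mem_sublists subseq_iota sorted_s lt_s mem_iota.
Qed.

Lemma uniq_keys k : uniq (keys k).
Proof.
have uniq_subs : uniq (sublists (iota 0 7)) by vm_compute.
rewrite /keys allpairs_uniq ?iota_uniq //; first exact: filter_uniq.
by move=> [? ?] [? ?].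
Qed.

Lemma keys_gt7 k : (7 < k)%N -> keys k = [::].
Proof.
move=> ltk; rewrite /keys /supports.
rewrite (eq_in_filter (a2 := pred0)) ?filter_pred0 //.
move=> s; rewrite mem_sublists => /size_subseq; rewrite size_iota => les.
by rewrite (ltn_eqF (leq_ltn_trans les ltk)).
Qed.

Lemma checks_all k : checks k.
Proof.
have [lek|ltk] := leqP k 7; first by apply: (allP checks_lt8); rewrite mem_iota.
have inv0 : invariant_keys k = [::] by do 8?[case: k ltk => [//|k] ltk].
rewrite /checks /homogeneous /square_zero_check /projection_check.
rewrite /pairing_check.
by rewrite (keys_gt7 ltk) inv0.
Qed.

(* Unfolding these while comparing terms would enumerate all the coordinates. *)
Strategy 100 [keys supports invariant_keys CE_form homotopy casimir
              invariant_projection memo].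

Lemma homogeneousP A k l b t :
  homogeneous A k l -> b \in keys k -> t \in A b -> t.2 \in keys l.
Proof. by rewrite /homogeneous => /allP h bk; apply: (allP (h b bk)). Qed.

Lemma checksP k :
  [/\ homogeneous CE_form k k.-1, homogeneous (homotopy on_g) k k.+1,
      homogeneous (homotopy on_V) k k.+1, square_zero_check k &
  [/\ projection_check k, pairing_check k &
      all (fun b => b \in keys k) (invariant_keys k)]].
Proof.
have := checks_all k; rewrite /checks => /and5P[? ? ? ?].
by case/and3P.
Qed.

Lemma mem_invariant_keys k b : b \in invariant_keys k -> b \in keys k.
Proof.
move=> bi; have [_ _ _ _ [_ _ h]] := checksP k.
exact: (allP h).
Qed.

(** * Cocycles in coordinates *)

Section Contraction.
Variable F : numFieldType.
Implicit Types (f g : key -> F) (b : key).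

Lemma eq_op_CE f g k b : b \in keys k ->
  {in keys k.-1, f =1 g} -> op CE_form f b = op CE_form g b.
Proof.
move=> bk fg; apply: eq_eval => _ /mapP[t td ->].
have [hd _ _ _ _] := checksP k.
exact: fg (homogeneousP hd bk td).
Qed.

Lemma op_linear A a f g b :
  op A (fun b => a * f b + g b) b = a * op A f b + op A g b.
Proof. exact: eval_linear. Qed.

Lemma eval_zero l : eval (fun _ => 0 : F) l = 0.
Proof. by rewrite /eval big1 // => t _; rewrite mulr0. Qed.

Lemma op_CE_CE f k b : b \in keys k -> op CE_form (op CE_form f) b = 0.
Proof.
have [_ _ _ + _] := checksP k; rewrite /square_zero_check => /allP h /h dd.
rewrite -[LHS]/(eval (op CE_form f) (CE_form b)) -eval_subst_form.
exact: eval_vanishes.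
Qed.

Definition cocycle_coords f :=
  forall k, {in keys k, op CE_form f =1 fun _ => 0}.

Definition homologous f f' :=
  exists g, forall k, {in keys k, forall b, f' b = f b + op CE_form g b}.

Lemma homologous_refl f : homologous f f.
Proof. by exists (fun _ => 0) => k b _; rewrite /op eval_zero addr0. Qed.

Lemma homologous_trans f1 f2 f3 :
  homologous f1 f2 -> homologous f2 f3 -> homologous f1 f3.
Proof.
move=> [g h] [g' h']; exists (fun b => 1 * g b + g' b) => k b bk.
by rewrite (h' k) // (h k) // op_linear mul1r addrA.
Qed.

Lemma homologousZ a f f' : homologous f f' ->
  homologous (fun b => a * f b) (fun b => a * f' b).
Proof.
move=> [g h]; exists (fun b => a * g b + 0) => k b bk.
by rewrite (h k) // mulrDr (op_linear _ _ _ (fun _ => 0)) /op eval_zero addr0.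
Qed.

Lemma eval_scalar_minus A c f l :
  eval f (scalar_minus A c l) = eval (fun b => Zr F c * f b - op A f b) l.
Proof.
rewrite /scalar_minus eval_collect eval_cat eval_oppr_form eval_scale_form.
rewrite eval_subst_form.
rewrite (eval_linear _ f (fun b => - op A f b)); congr (_ + _).
by rewrite /eval -sumrN; apply: eq_bigr => t _; rewrite mulrN.
Qed.

(** On a cocycle f, d H + H d is the coboundary d (H f). *)
Lemma scalar_minus_casimir (P : pred nat) c f :
  (forall k, homogeneous (homotopy P) k k.+1) ->
  cocycle_coords f ->
  cocycle_coords (fun b => Zr F c * f b - op (casimir P) f b) /\
  homologous (fun b => Zr F c * f b)
             (fun b => Zr F c * f b - op (casimir P) f b).
Proof.
move=> hP cf.
have casE k b : b \in keys k ->
    op (casimir P) f b = op CE_form (op (homotopy P) f) b.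
  move=> bk; rewrite /op eval_collect eval_cat !eval_subst_form.
  rewrite [X in X + _](_ : _ = 0) ?add0r // -[RHS](eval_zero (homotopy P b)).
  apply: eq_eval => _ /mapP[t tb ->]; apply: (cf k.+1).
  exact: homogeneousP (hP k) bk tb.
have dcas g :
    (forall k b, b \in keys k -> op (casimir P) f b = op CE_form g b) ->
    forall k b, b \in keys k ->
      - op (casimir P) f b = op CE_form (fun b => -1 * g b + 0) b.
  move=> e k b bk; rewrite (op_linear _ _ _ (fun _ => 0)) (e k) //.
  by rewrite /op eval_zero addr0 mulN1r.
split; last first.
  by eexists => k b bk; congr (_ + _); apply: dcas casE k b bk.
move=> k b bk.
rewrite (op_linear CE_form _ f (fun b => - _)) (cf k) // mulr0 add0r.
rewrite (eq_op_CE bk (g := op CE_form (fun b => -1 * op (homotopy P) f b + 0))).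
  exact: op_CE_CE bk.
exact: dcas casE _.
Qed.

(** The invariant class has four nonzero coordinates, all equal to 1, hence the
    factor 1/4. *)
Definition invariant_pairing k f : F := 4^-1 * \sum_(b <- invariant_keys k) f b.

Lemma Zr_eq0 n : (Zr F n == 0) = (n == 0%BZ).
Proof. by rewrite /Zr intr_eq0 -(can_eq int_of_ZK). Qed.

Lemma Zr_prod n cs :
  Zr F (foldr Z.mul n cs) = Zr F n * foldr (fun c x => Zr F c * x) 1 cs.
Proof.
by elim: cs => [|c cs IH] /=; rewrite ?mulr1 // ZrM IH mulrCA.
Qed.

(** Replacing f by (c - casimir) f changes c f by a coboundary. Doing this for
    all the eigenvalues turns f, up to the normalizer, into its invariant
    projection, which the verification identifies. *)
Lemma cocycle_coords_decomposition f : cocycle_coords f -> exists g, forall k,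
  {in keys k, forall b,
    f b = (b \in invariant_keys k)%:R * invariant_pairing k f + op CE_form g b}.
Proof.
move=> cf.
have chain cs (h : key -> F) : cocycle_coords h -> exists h',
  [/\ cocycle_coords h',
    homologous (fun b => foldr (fun c x => Zr F c * x) 1 cs * h b) h' &
    forall l, eval h (foldr (scalar_minus (casimir on_V)) l cs) = eval h' l].
  elim: cs h => [|c cs IH] h ch /=.
    exists h; split=> //; under [X in homologous X]eq_fun do rewrite mul1r.
    exact: homologous_refl.
  have hV k : homogeneous (homotopy on_V) k k.+1 by case: (checksP k).
  have [cl hom] := scalar_minus_casimir c hV ch.
  have [h' [ch' hom' ev]] := IH _ cl; exists h'; split=> // [|l]; last first.
    by rewrite eval_scalar_minus.
  apply: homologous_trans hom'; rewrite (_ : (fun b => _) = (fun b =>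
    foldr (fun c x => Zr F c * x) 1 cs * (Zr F c * h b))).
    exact: homologousZ.
  by apply/funext => b; rewrite mulrCA mulrA.
have [h [ch hom ev]] := chain eigenvalues f cf.
have hg j : homogeneous (homotopy on_g) j j.+1 by case: (checksP j).
have [_ hom8] := scalar_minus_casimir 8%BZ hg ch.
have [g gE] := homologous_trans (homologousZ (Zr F 8) hom) hom8.
exists (fun b => - (Zr F normalizer)^-1 * g b + 0) => k b bk.
rewrite (op_linear _ _ _ (fun _ => 0)) /op eval_zero addr0 -/(op CE_form g b).
have N0 : Zr F normalizer != 0 by rewrite Zr_eq0.
apply: (mulfI N0).
have := gE k b bk; rewrite mulrA -Zr_prod -/normalizer.
move=> /esym/(canRL (addrK _)) ->.
rewrite mulrDr mulNr mulrN mulVKf //; congr (_ - _).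
have -> : Zr F 8 * h b - op (casimir on_g) h b =
    eval f (invariant_projection (casimir on_V) (casimir on_g) b).
  rewrite /invariant_projection ev eval_scalar_minus.
  by rewrite /eval big_cons big_nil addr0 Zr1 mul1r.
have [_ _ _ _ [+ _ _]] := checksP k.
rewrite /projection_check !memoE => /allP/(_ b bk)/(@eval_vanishes F f).
rewrite eval_cat eval_oppr_form => /eqP; rewrite subr_eq0 => /eqP ->.
rewrite /rank_one; case: ifP => _; last by rewrite mul0r mulr0 /eval big_nil.
rewrite mul1r /invariant_pairing mulrA (@Zr_div4 _ normalizer) //.
rewrite mulfK ?pnatr_eq0 //.
by rewrite /eval big_map mulr_sumr.
Qed.

End Contraction.

(** * Coordinates of cochains *)

Section Coordinates.
Variables (F : numFieldType) (L : lieAlgType F).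
Variables (e : nat -> L) (xi : nat -> L -> F).
Implicit Types (W : seq L -> ad L) (f g : key -> F).

Definition standard_basis :=
  [/\ forall i, scalar (xi i),
      forall i j, (i < 7)%N -> (j < 7)%N -> xi i (e j) = (i == j)%:R,
      forall x, x = \sum_(i < 7) xi i x *: e i &
      forall i j, (i < 7)%N -> (j < 7)%N ->
        lie (e i) (e j) = Zr F (bracket i j).1 *: e (bracket i j).2].

Hypothesis basis_e : standard_basis.

Lemma bracket_lt a b : ((bracket a b).2 < 7)%N.
Proof.
by rewrite /bracket; do 7?[case: a => [|a]]; do 7?[case: b => [|b]];
  rewrite /= ?nth_nil.
Qed.

Let xi_linear i : scalar (xi i). Proof. by case: basis_e. Qed.
HB.instance Definition _ i :=
  GRing.isLinear.Build F L F *%R (xi i) (xi_linear i).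

Let xi_e i j : (i < 7)%N -> (j < 7)%N -> xi i (e j) = (i == j)%:R.
Proof. by case: basis_e => _ + _ _; apply. Qed.

Let e_span x : x = \sum_(i < 7) xi i x *: e i.
Proof. by case: basis_e. Qed.

Let lie_e i j : (i < 7)%N -> (j < 7)%N ->
  lie (e i) (e j) = Zr F (bracket i j).1 *: e (bracket i j).2.
Proof. by case: basis_e => _ _ _; apply. Qed.

Definition coords W (b : key) : F := xi b.2 (W [seq e i | i <- b.1]).

Lemma eval_prepend W y l :
  eval (coords W) (prepend y l) = eval (coords (fun s => W (e y :: s))) l.
Proof. by rewrite /eval big_map. Qed.

Lemma eval_arg_terms W y s c : multilin W -> (y < 7)%N -> all (gtn 7) s ->
  eval (coords W) (arg_terms on_g y s c) =
  xi c (arg_act (e y) W [seq e i | i <- s]).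
Proof.
move=> + lty; elim: s W => [|a s IH] W mW /=.
  by rewrite /eval big_nil linear0.
move=> /andP[lta lts]; rewrite eval_cons eval_prepend IH //=; last first.
  exact: multilin_cons.
by rewrite linearD lie_e // (multilinZ [::]) //= linearZ.
Qed.

Lemma eval_val_terms W y s c : (y < 7)%N -> (c < 7)%N ->
  eval (coords W) (val_terms y s c) =
  xi c (lie_act (e y) (W [seq e i | i <- s])).
Proof.
move=> lty ltc; set w := W _.
have -> : lie_act (e y) w =
    \sum_(a < 7) (xi a w * Zr F (bracket y a).1) *: e (bracket y a).2.
  rewrite {1}[w]e_span; rewrite -[lie_act _ _]/(lie (e y) _).
  have lie_lin : linear (lie (e y)) := lie_linearr (e y).
  pose lie_y := GRing.isLinear.Build F L L *:%R (lie (e y)) lie_lin.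
  pose ad_y : {linear L -> L} := HB.pack (lie (e y)) lie_y.
  rewrite -[lie _ _]/(ad_y _) linear_sum; apply: eq_bigr => a _.
  by rewrite linearZ /= lie_e // scalerA.
rewrite linear_sum /eval big_map big_filter -[7%N]/(7 - 0)%N.
rewrite -/(index_iota 0 7) big_mkord big_mkcond; apply: eq_bigr => a _.
rewrite linearZ /= xi_e ?bracket_lt // eq_sym; case: ifP => _.
  by rewrite mulr1 mulrC.
by rewrite mulr0.
Qed.

Lemma eval_CE_terms W s c : multilin W -> all (gtn 7) s -> (c < 7)%N ->
  eval (coords W) (CE_terms s c) = xi c (CE_list W [seq e i | i <- s]).
Proof.
move=> + + ltc; elim: s W => [|y s IH] W mW /=.
  by rewrite /eval big_nil linear0.
move=> /andP[lty lts].
rewrite /act_terms !eval_cat !eval_oppr_form eval_prepend.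
rewrite IH ?eval_arg_terms ?eval_val_terms //; last exact: multilin_cons.
by rewrite !linearB.
Qed.

Lemma coords_CE_list W k b : multilin W -> alternating W -> b \in keys k ->
  coords (CE_list W) b = op CE_form (coords W) b.
Proof.
case: b => s c mW aW; rewrite mem_keys => /and4P[_ lts _ ltc].
rewrite /op eval_collect eval_straighten ?eval_CE_terms // => c'.
have [W0 WN] := aW.
split=> [s' x t|s' x y t]; rewrite /coords /= !map_cat /=.
  by rewrite W0 linear0.
by rewrite WN linearN.
Qed.

(** Multilinearity reduces to lists of basis vectors, and alternation to sorted
    ones. *)
Lemma coords_eq0 W : multilin W -> alternating W ->
  (forall k, {in keys k, coords W =1 fun _ => 0}) -> forall X, W X = 0.
Proof.
move=> mW aW W0 X.
have basis0 s : all (gtn 7) s -> W [seq e i | i <- s] = 0.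
  move=> lts; rewrite (@sort_sign_scale F _ (fun r => W [seq e i | i <- r])).
    rewrite [X in _ *: X]e_span big1 ?scaler0 // => c _.
    have := W0 (size (sort_sign s).2) ((sort_sign s).2, c : nat).
    rewrite mem_keys sorted_sort_sign all_sort_sign // eqxx ltn_ord.
    by rewrite /coords /= => ->; rewrite ?scale0r.
  have [Wa WN] := aW; split=> [s' x t|s' x y t]; rewrite !map_cat /=.
    exact: Wa.
  exact: WN.
suff : forall s, all (gtn 7) s -> W ([seq e i | i <- s] ++ X) = 0.
  by move/(_ [::]) => ->.
elim: X => [|x X IH] s lts; first by rewrite cats0 basis0.
pose slot := GRing.isLinear.Build F L (ad L) *:%R
  (fun u => W ([seq e i | i <- s] ++ u :: X)) (mW _ X).
pose Wx : {linear L -> ad L} :=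
  HB.pack (fun u => W ([seq e i | i <- s] ++ u :: X)) slot.
rewrite -[W _]/(Wx x) [x]e_span linear_sum big1 // => i _.
rewrite linearZ /= -cat_rcons -map_rcons IH ?scaler0 //.
by rewrite all_rcons lts /= ltn_ord.
Qed.

(** The determinant is the value of the wedge product e_s^* of coordinate forms. *)
Definition cochain_of k f : ('I_k -> L) -> ad L := fun x =>
  \sum_(b <- keys k)
    (f b * \det (\matrix_(i < k, j < k) xi (nth 0%N b.1 j) (x i))) *: e b.2.

Arguments cochain_of : clear implicits.

Lemma alternating_cochain_of k f : alternating_multilinear (cochain_of k f).
Proof.
split=> [x i a u v|x i j ij xij]; last first.
  rewrite /cochain_of big1 // => b _; rewrite (determinant_alternate ij).
    by rewrite mulr0 scale0r.
  by move=> l; rewrite !mxE xij.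
rewrite /cochain_of scaler_sumr -big_split /=; apply: eq_bigr => b _.
rewrite scalerA -scalerDl; congr (_ *: _).
rewrite mulrCA -mulrDr; congr (_ * _).
pose A z : 'M_k :=
  \matrix_(l, j) xi (nth 0%N b.1 j) ([eta x with i |-> z] l).
rewrite -[LHS]/(\det (A _)) -/(A u) -/(A v) -[\det (A v)]mul1r.
apply: (determinant_multilinear (i0 := i)).
- by apply/rowP => l; rewrite !mxE /= eqxx linearP mul1r.
- by apply/matrixP => l m; rewrite !mxE /= eq_sym (negPf (neq_lift _ _)).
- by apply/matrixP => l m; rewrite !mxE /= eq_sym (negPf (neq_lift _ _)).
Qed.

(** If s is not t, some entry of s is missing in t and gives a zero row. *)
Lemma det_basis k s t c c' : (s, c) \in keys k -> (t, c') \in keys k ->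
  \det (\matrix_(i < k, j < k) xi (nth 0%N t j) (e (nth 0%N s i))) =
  (s == t)%:R :> F.
Proof.
rewrite !mem_keys => /and4P[ss /allP lts /eqP sz_s _].
move=> /and4P[st /allP ltt /eqP sz_t _].
have entry (i j : 'I_k) : xi (nth 0%N t j) (e (nth 0%N s i)) =
    (nth 0%N t j == nth 0%N s i)%:R.
  by rewrite xi_e //; [apply: ltt | apply: lts]; rewrite mem_nth ?sz_s ?sz_t.
case: eqVneq => [st_eq|neq].
  rewrite (_ : \matrix_(i, j) _ = 1%:M) ?det1 //; apply/matrixP => i j.
  rewrite !mxE entry st_eq nth_uniq ?sz_t // 1?eq_sym //.
  exact: sorted_uniq ltn_trans ltnn _ st.
have /allPn[a sa ta] : ~~ all (mem t) s.
  apply: contra neq => /allP sub; apply/eqP.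
  apply: (irr_sorted_eq ltn_trans ltnn) => //.
  have [|_ eq_st] := uniq_min_size (sorted_uniq ltn_trans ltnn ss) sub.
    by rewrite sz_s sz_t.
  exact: eq_st.
have lt_a : (index a s < k)%N by rewrite -sz_s index_mem.
rewrite (expand_det_row _ (Ordinal lt_a)) big1 // => j _; rewrite mxE entry /=.
rewrite nth_index // [_ == a](_ : _ = false) ?mul0r //.
by apply: contraNF ta => /eqP <-; apply: mem_nth; rewrite sz_t.
Qed.

Lemma coords_cochain_of k f b : b \in keys k ->
  coords (on_list (cochain_of k f)) b = f b.
Proof.
move=> bk; case: b bk => s c bk; have := bk.
rewrite mem_keys => /and4P[_ _ /eqP sz ltc].
rewrite /coords /on_list size_map sz eqxx /cochain_of linear_sum /=.
rewrite (bigD1_seq (s, c)) ?uniq_keys //= big1_seq ?addr0.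
  rewrite linearZ /= xi_e // eqxx mulr1 -[RHS]mulr1; congr (_ * _).
  transitivity (\det (\matrix_(i < k, j < k)
                  xi (nth 0%N s j) (e (nth 0%N s i)))).
    congr (\det _); apply/matrixP => i j.
    by rewrite !mxE (nth_map 0%N) // sz.
  by rewrite (det_basis bk bk) eqxx.
move=> [t c'] /andP[neq tk]; rewrite linearZ /= xi_e //; last first.
  by move: tk; rewrite mem_keys => /and4P[].
rewrite (_ : \det _ = (s == t)%:R).
  case: (eqVneq s t) neq => [<-|_ _]; last by rewrite mulr0 mul0r.
  by rewrite xpair_eqE eqxx /= eq_sym => /negPf ->; rewrite mulr0.
rewrite -(det_basis bk tk); congr (\det _); apply/matrixP => i j.
by rewrite !mxE (nth_map 0%N) // sz.
Qed.

Definition invariant_cochain k : ('I_k -> L) -> ad L :=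
  cochain_of k (fun b => (b \in invariant_keys k)%:R).

Arguments invariant_cochain : clear implicits.

Lemma alternating_invariant_cochain k :
  alternating_multilinear (invariant_cochain k).
Proof. exact: alternating_cochain_of. Qed.

Lemma coords_on_list_neq k (w : ('I_k -> L) -> ad L) j b : b \in keys j ->
  j != k -> coords (on_list w) b = 0.
Proof.
case: b => s c; rewrite mem_keys => /and4P[_ _ /eqP sz _] /negPf jk.
by rewrite /coords /on_list size_map sz jk linear0.
Qed.

Lemma coords_CE_d k (w : ('I_k -> L) -> ad L) j b :
  alternating_multilinear w -> b \in keys j ->
  coords (on_list (CE_d w)) b = op CE_form (coords (on_list w)) b.
Proof.
move=> aw bj; rewrite on_list_CE_d //; apply: coords_CE_list bj.
  exact: multilin_on_list.
exact: alternating_on_list.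
Qed.

Lemma on_list_inj k (w w' : ('I_k -> L) -> ad L) : on_list w =1 on_list w' ->
  w = w'.
Proof. by move=> ww'; apply/funext => x; rewrite -!on_list_codom ww'. Qed.

Lemma op_CE_keys0 f b : b \in keys 0 -> op CE_form f b = 0.
Proof.
case: b => s c; rewrite mem_keys => /and4P[_ _ /nilP -> _].
by rewrite /op /eval big_nil.
Qed.

Lemma CE_d_invariant_cochain k : CE_d (invariant_cochain k) = 0.
Proof.
have az := alternating_invariant_cochain k.
apply: on_list_inj => X; rewrite on_list_CE_d //.
rewrite [RHS](_ : _ = 0); last by rewrite /on_list; case: ifP.
apply: coords_eq0 => [||j b bj].
- exact/multilin_CE_list/multilin_on_list.
- apply: alternating_CE_list; first exact: multilin_on_list.
  exact: alternating_on_list.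
rewrite -on_list_CE_d // (coords_CE_d az bj); case: j bj => [|j] bj.
  exact: op_CE_keys0.
case: (eqVneq j k) => [jk|jk].
  subst k.
  rewrite (eq_op_CE (g := fun b' => (b' \in invariant_keys j)%:R) bj);
    last first.
    by move=> b' b'j; exact: coords_cochain_of b'j.
  have [_ _ _ _ [_ + _]] := checksP j.+1.
  rewrite /pairing_check => /andP[_ /allP/(_ b bj)/Z.eqb_spec tot0].
  transitivity (Zr F (coef_sum (mem (invariant_keys j)) (CE_form b)));
    last by rewrite tot0.
  rewrite /op; elim: (CE_form b) => [|t l IH] /=.
    by rewrite /eval big_nil.
  rewrite eval_cons IH; case: ifP => _; first by rewrite ZrD mulr1.
  by rewrite mulr0 add0r.
rewrite (eq_op_CE (g := fun=> 0) bj) /op ?eval_zero // => b' b'j.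
exact: coords_on_list_neq b'j jk.
Qed.

Lemma coords_inj W W' : multilin W -> alternating W -> multilin W' ->
  alternating W' -> (forall k, {in keys k, coords W =1 coords W'}) -> W =1 W'.
Proof.
move=> mW aW mW' aW' eqW X; apply/eqP; rewrite -subr_eq0 addrC -scaleN1r.
apply/eqP; move: X; apply: coords_eq0.
- exact: multilin_comb.
- exact: alternating_comb.
move=> k b bk; rewrite /coords linearD linearZ /=.
by have := eqW k b bk; rewrite /coords => ->; rewrite mulN1r addNr.
Qed.

(** The decomposition of the coordinates is one of cochains, because [CE_d v] is
    alternating and thus determined by its coordinates. *)
Lemma cocycle_decomposition k (w : ('I_k.+1 -> L) -> ad L) :
  alternating_multilinear w -> CE_d w = 0 ->
  exists2 v : ('I_k -> L) -> ad L, alternating_multilinear v &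
    w = invariant_pairing k.+1 (coords (on_list w)) *: invariant_cochain k.+1
        + CE_d v.
Proof.
move=> aw dw.
have cocycle_w : cocycle_coords (coords (on_list w)).
  move=> j b bj; rewrite -(coords_CE_d aw bj) dw.
  by rewrite /coords /on_list; case: ifP => _; rewrite linear0.
have [g gE] := cocycle_coords_decomposition cocycle_w.
exists (cochain_of k g); first exact: alternating_cochain_of.
apply: on_list_inj; set a := invariant_pairing _ _.
have -> : on_list (a *: invariant_cochain k.+1 + CE_d (cochain_of k g)) =
    fun X => a *: on_list (invariant_cochain k.+1) X
             + on_list (CE_d (cochain_of k g)) X.
  by apply/funext => X; rewrite /on_list; case: ifP; rewrite ?scaler0 ?addr0.
have az := alternating_invariant_cochain k.+1.
have av := alternating_cochain_of k g.
rewrite on_list_CE_d //; apply: coords_inj.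
- exact: multilin_on_list.
- exact: alternating_on_list.
- apply: multilin_comb; first exact: multilin_on_list.
  exact/multilin_CE_list/multilin_on_list.
- apply: alternating_comb; first exact: alternating_on_list.
  apply: alternating_CE_list; first exact: multilin_on_list.
  exact: alternating_on_list.
move=> j b bj; rewrite /coords linearD linearZ /= -!/(coords _ b).
rewrite -on_list_CE_d // (coords_CE_d av bj).
have [jk|jk] := eqVneq j k.+1; last first.
  rewrite !(coords_on_list_neq _ bj) // mulr0 add0r -(coords_CE_d av bj).
  by rewrite (coords_on_list_neq _ bj).
subst j; rewrite coords_cochain_of // (gE _ b bj) mulrC; congr (_ + _).
by apply: eq_op_CE bj _ => b' b'k; rewrite coords_cochain_of.
Qed.

Lemma cocycle0_eq0 (w : ('I_0 -> L) -> ad L) :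
  alternating_multilinear w -> CE_d w = 0 -> w = 0.
Proof.
move=> aw dw.
have cocycle_w : cocycle_coords (coords (on_list w)).
  move=> j b bj; rewrite -(coords_CE_d aw bj) dw.
  by rewrite /coords /on_list; case: ifP => _; rewrite linear0.
have [g gE] := cocycle_coords_decomposition cocycle_w.
apply: on_list_inj => X; rewrite [RHS](_ : _ = 0); last first.
  by rewrite /on_list; case: ifP.
apply: coords_eq0 => [||j b bj].
- exact: multilin_on_list.
- exact: alternating_on_list.
case: j bj => [|j] bj; last exact: coords_on_list_neq bj _.
by rewrite (gE _ b bj) op_CE_keys0 // mul0r addr0.
Qed.

Lemma invariant_pairing_coboundary k f :
  invariant_pairing k (op CE_form f) = 0 :> F.
Proof.
have [_ _ _ _ [_ + _]] := checksP k.
rewrite /pairing_check => /andP[/(@eval_vanishes F f) + _].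
rewrite eval_subst_form /eval big_map /invariant_pairing => sum0.
rewrite [X in _ * X](_ : _ = 0) ?mulr0 // -[RHS]sum0.
by apply: eq_bigr => b _; rewrite Zr1 mul1r.
Qed.

(** The pairing vanishes on coboundaries and is 1 on the invariant cochain. *)
Lemma invariant_cochain_not_coboundary k (v : ('I_k -> L) -> ad L) a :
  k.+1 \in [:: 1; 3; 4; 6]%N -> alternating_multilinear v ->
  a *: invariant_cochain k.+1 = CE_d v -> a = 0.
Proof.
move=> kin av zE.
have inv b : b \in invariant_keys k.+1 ->
    a * (b \in invariant_keys k.+1)%:R = op CE_form (coords (on_list v)) b.
  move=> /mem_invariant_keys bk; rewrite -(coords_CE_d av bk) -zE.
  rewrite -(coords_cochain_of (fun b => (b \in invariant_keys k.+1)%:R) bk).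
  rewrite /coords -linearZ; congr (xi _ _); rewrite /on_list.
  by case: ifP; rewrite ?scaler0.
have := invariant_pairing_coboundary k.+1 (coords (on_list v)).
rewrite /invariant_pairing big_seq -(eq_bigr _ inv) -big_seq -mulr_sumr.
rewrite (_ : \sum_(b <- _) _ = 4).
  by rewrite mulrCA mulVf ?mulr1 // pnatr_eq0.
rewrite big_seq (eq_bigr (fun=> 1)) => [|b ->//].
rewrite -big_seq big_const_seq.
rewrite count_predT iter_addr_0; congr (_ *+ _).
by move: kin; rewrite !inE => /or4P[] /eqP [->].
Qed.

End Coordinates.

Arguments invariant_cochain [F L] e xi k x.

(** * The cohomology *)

Lemma line_isomorphic (F : fieldType) (U : lmodType F) (u : U) :
  (forall a : F, a *: u = 0 -> a = 0) -> (forall x, exists a : F, x = a *: u) ->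
  lmod_isomorphic U F^o.
Proof.
move=> u_free u_gen; pose f x : F^o := sval (cid (u_gen x)).
have fE x : x = f x *: u := svalP (cid (u_gen x)).
have fZ (a : F) : f (a *: u) = a.
  apply/eqP; rewrite -subr_eq0; apply/eqP/u_free.
  by rewrite scalerBl -fE subrr.
have f_linear : linear f.
  by move=> a x y; rewrite [x]fE [y]fE scalerA -scalerDl !fZ.
pose fL : {linear U -> F^o} :=
  HB.pack f (GRing.isLinear.Build F U F^o *:%R f f_linear).
exists fL; exists (fun a : F^o => a *: u) => [x|a] /=; first by rewrite -fE.
exact: fZ.
Qed.

Lemma invariant_keys_nil k :
  k \notin [:: 1; 3; 4; 6]%N -> invariant_keys k = [::].
Proof. by do 7?[case: k => [//|k]]. Qed.

Section Cohomology.
Variables (F : numFieldType) (L : lieAlgType F).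
Variables (e : nat -> L) (xi : nat -> L -> F).
Hypothesis basis_e : standard_basis e xi.

Local Notation cocycles k := (@cocycles F L (ad L) k).

Lemma cocycle_spec k (z : cocycles k) :
  alternating_multilinear (val z) /\ CE_d (val z) = 0.
Proof. exact/asboolP/(valP z). Qed.

Definition coclass k (z : cocycles k) : CE_cohomology (ad L) k :=
  quotmod_pi (@coboundary_submod F L (ad L) k) z.

Lemma coclass_eqP k (z z' : cocycles k) :
  coclass z = coclass z' <-> is_coboundary (val z - val z').
Proof.
rewrite /coclass quotmod_piP; split=> [/asboolP|h]; last exact/asboolP.
by [].
Qed.

Lemma coclassP k (c : CE_cohomology (ad L) k) : exists z, c = coclass z.
Proof. by eexists; rewrite -[LHS]quotmod_piK. Qed.

Lemma coclass0 k : coclass (0 : cocycles k) = 0.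
Proof. exact: raddf0. Qed.

Lemma coclassZ k a (z : cocycles k) : coclass (a *: z) = a *: coclass z.
Proof. exact: quotmod_piZ. Qed.

Lemma standard_cohomology k :
  if k \in [:: 1; 3; 4; 6]%N then lmod_isomorphic (CE_cohomology (ad L) k) F^o
  else forall c : CE_cohomology (ad L) k, c = 0.
Proof.
case: k => [|k].
  move=> /= c; have [z ->] := coclassP c; have [az dz] := cocycle_spec z.
  rewrite -coclass0; apply/coclass_eqP.
  rewrite /= (cocycle0_eq0 basis_e az dz).
  exact: subr0.
case: ifP => kin; last first.
  move=> c; have [z ->] := coclassP c; have [az dz] := cocycle_spec z.
  have [v av vE] := cocycle_decomposition basis_e az dz.
  rewrite -coclass0; apply/coclass_eqP; exists v => //.
  rewrite [LHS]subr0 vE [X in X *: _](_ : _ = 0) ?scale0r ?add0r //.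
  by rewrite /invariant_pairing invariant_keys_nil ?kin // big_nil mulr0.
have gen_cocycle : @cocycle F L (ad L) k.+1 (invariant_cochain e xi k.+1).
  apply/asboolP; split; first exact: alternating_invariant_cochain.
  exact: CE_d_invariant_cochain.
pose z0 : cocycles k.+1 :=
  exist (fun w => @cocycle F L (ad L) k.+1 w) _ gen_cocycle.
apply: (@line_isomorphic _ _ (coclass z0)) => [a|c].
  rewrite -coclassZ -coclass0 => /coclass_eqP[v av].
  rewrite [LHS]subr0 linearZ => vE.
  exact (invariant_cochain_not_coboundary basis_e kin av vE).
have [z ->] := coclassP c; have [az dz] := cocycle_spec z.
have [v av vE] := cocycle_decomposition basis_e az dz.
set a := invariant_pairing _ _ in vE; exists a; rewrite -coclassZ.
apply/coclass_eqP.
exists v => //; rewrite -[LHS]/(val z - a *: invariant_cochain e xi k.+1).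
by move: a vE => a ->; rewrite addrC addKr.
Qed.

End Cohomology.

(** * The standard basis of the irreducible module of dimension 4 *)

Section SL2.
Variable F : fieldType.

Lemma traceless_sl2e : traceless F 2 (delta_mx 0 1).
Proof.
by apply/eqP; rewrite /mxtrace !big_ord_recl big_ord0 !mxE /= !addr0.
Qed.

Lemma traceless_sl2f : traceless F 2 (delta_mx 1 0).
Proof.
by apply/eqP; rewrite /mxtrace !big_ord_recl big_ord0 !mxE /= !addr0.
Qed.

Lemma traceless_sl2h : traceless F 2 (delta_mx 0 0 - delta_mx 1 1).
Proof.
apply/eqP; rewrite /mxtrace !big_ord_recl big_ord0 !mxE /=.
by rewrite addr0 subr0 sub0r subrr.
Qed.

Definition sl2e : sl F 2 := exist (fun A => traceless F 2 A) _ traceless_sl2e.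
Definition sl2h : sl F 2 := exist (fun A => traceless F 2 A) _ traceless_sl2h.
Definition sl2f : sl F 2 := exist (fun A => traceless F 2 A) _ traceless_sl2f.

Lemma sl2_eq (x y : sl F 2) : val x 0 0 = val y 0 0 ->
  val x 0 1 = val y 0 1 -> val x 1 0 = val y 1 0 -> x = y.
Proof.
have tr (z : sl F 2) : val z 1 1 = - val z 0 0.
  have /eqP := valP z; rewrite /mxtrace !big_ord_recl big_ord0 /= addr0 => trz.
  apply/eqP; rewrite -addr_eq0 addrC; apply/eqP; rewrite -[RHS]trz.
  by congr (val z _ _ + val z _ _); apply/val_inj.
move=> e00 e01 e10; apply/val_inj/matrixP => i j.
have ord2 (k : 'I_2) : k = 0 \/ k = 1.
  by case: k => [[|[|//]] ?]; [left | right]; apply/val_inj.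
have [-> | ->] := ord2 i; have [-> | ->] := ord2 j => //.
by rewrite !tr e00.
Qed.

Lemma lie_he : lie sl2h sl2e = 2 *: sl2e :> sl F 2.
Proof.
by apply: sl2_eq; rewrite !mxE !big_ord_recl !big_ord0 !mxE /=; ring.
Qed.

Lemma lie_hf : lie sl2h sl2f = - 2 *: sl2f :> sl F 2.
Proof.
by apply: sl2_eq; rewrite !mxE !big_ord_recl !big_ord0 !mxE /=; ring.
Qed.

Lemma lie_ef : lie sl2e sl2f = sl2h :> sl F 2.
Proof.
by apply: sl2_eq; rewrite !mxE !big_ord_recl !big_ord0 !mxE /=; ring.
Qed.

Lemma sl2_decomp (x : sl F 2) :
  x = val x 0 1 *: sl2e + val x 0 0 *: sl2h + val x 1 0 *: sl2f.
Proof. by apply: sl2_eq; rewrite !mxE /=; ring. Qed.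

End SL2.

Section V3.
Variables (F : numClosedFieldType) (V : lieVectType (sl F 2)).
Local Notation E := (@lie_act F (sl F 2) V (sl2e F)).
Local Notation H := (@lie_act F (sl F 2) V (sl2h F)).
Local Notation Fo := (@lie_act F (sl F 2) V (sl2f F)).

HB.instance Definition _ (x : sl F 2) := GRing.isLinear.Build F V V *:%R
  (lie_act x : V -> V) (lie_act_linearr x).

Lemma lie_actZl (a : F) (x : sl F 2) (v : V) :
  lie_act (a *: x) v = a *: lie_act x v.
Proof.
by have /= := lie_act_linearl v a x 0; rewrite lie_act0l !addr0.
Qed.

Lemma lie_actDl (x y : sl F 2) (v : V) :
  lie_act (x + y) v = lie_act x v + lie_act y v.
Proof. by have := lie_act_linearl v 1 x y; rewrite !scale1r. Qed.

Lemma act_he v : H (E v) = E (H v) + 2 *: E v.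
Proof. by rewrite -lie_actZl -lie_he lie_act_lie addrC subrK. Qed.

Lemma act_hf v : H (Fo v) = Fo (H v) - 2 *: Fo v.
Proof. by rewrite -scaleNr -lie_actZl -lie_hf lie_act_lie addrC subrK. Qed.

Lemma act_ef v : E (Fo v) = Fo (E v) + H v.
Proof. by rewrite -(lie_ef F) lie_act_lie addrC subrK. Qed.

(** The characteristic polynomial of h has finitely many roots, so some weight a
    is such that a + 2 is not a weight. *)
Lemma highest_weight_vector : fullv != 0%VS :> {vspace V} ->
  exists (a : F) (v : V), [/\ v != 0, H v = a *: v & E v = 0].
Proof.
rewrite -dimv_eq0 -lt0n => dim_gt0.
pose b := vbasis (fullv : {vspace V}).
have bP : basis_of fullv b := vbasisP _.
pose A := passmx.mxof b b (linfun H).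
have rootP a : reflect (exists2 v : V, v != 0 & H v = a *: v)
    (root (char_poly A) a).
  rewrite -eigenvalue_root_char /eigenvalue -(passmx.vsof_eq0 bP).
  rewrite -(passmx.leigenspaceE bP); apply: (iffP idP) => [nz|[v v0 Hv]].
    exists (vpick (passmx.leigenspace (linfun H) a)); first by rewrite vpick0.
    have := memv_pick (passmx.leigenspace (linfun H) a).
    rewrite memv_ker add_lfunE opp_lfunE scale_lfunE id_lfunE lfunE subr_eq0.
    by move/eqP.
  apply: contraNneq v0 => e0; rewrite -memv0 -e0 memv_ker.
  by rewrite add_lfunE opp_lfunE scale_lfunE id_lfunE lfunE /= Hv subrr.
have [a ra] : exists a, root (char_poly A) a.
  have [a] := spectral.eigenvalue_closed A dim_gt0.
  by rewrite eigenvalue_root_char; exists a.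
have [j] : exists j, ~~ root (char_poly A) (a + (2 * j)%:R).
  apply: contrapT => /forallNP all_root.
  have := @max_poly_roots _ (char_poly A)
    [seq a + (2 * j)%:R | j <- iota 0 (size (char_poly A))].
  rewrite size_map size_iota ltnn => H; suff : false by [].
  apply: H; first exact/monic_neq0/char_poly_monic.
    apply/allP => _ /mapP[j _ ->]; apply/negPn/negP; exact: all_root.
  rewrite map_inj_uniq ?iota_uniq // => i j /addrI /eqP.
  by rewrite eqr_nat eqn_pmul2l // => /eqP.
move=> nrj; have ex : exists j, ~~ root (char_poly A) (a + (2 * j)%:R).
  by exists j.
case: (ex_minnP ex) => [[|m]]; first by rewrite muln0 addr0 ra.
move=> nr /(_ m); case: (boolP (root _ (a + (2 * m)%:R))); last first.
  by move=> _ /(_ isT); rewrite ltnn.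
move=> /rootP[v v0 Hv] _; exists (a + (2 * m)%:R), v; split=> //.
apply/eqP; apply: contraR nr => Ev; apply/rootP; exists (E v) => //.
rewrite act_he Hv linearZ /= -scalerDl mulnS natrD; congr (_ *: _); ring.
Qed.

(** Let w be a highest weight vector, of weight a, and v_i = f^i w. The v_i that
    precede the first linear dependence span a submodule, hence all of V, so
    that v_0, ..., v_3 is a basis. Then v_4 is a combination of them, which must
    vanish because its weight a - 8 differs from theirs, and e v_4 = 4 (a - 3)
    v_3 gives a = 3. *)
Lemma V3_basis : is_V 3 V -> exists v : nat -> V,
  [/\ basis_of fullv [tuple v i | i < 4], v 4%N = 0,
      forall i, H (v i) = (3 - (2 * i)%:R) *: v i,
      forall i, Fo (v i) = v i.+1 &
      forall i, E (v i) = (i%:R * (4 - i%:R)) *: v i.-1].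
Proof.
move=> [[nz irr] dimV]; have [a [w [w0 Hw Ew]]] := highest_weight_vector nz.
pose v i := iter i Fo w.
have Hv i : H (v i) = (a - (2 * i)%:R) *: v i.
  elim: i => [|i IH] /=; first by rewrite muln0 subr0.
  rewrite act_hf IH linearZ /= -scalerBl mulnS natrD; congr (_ *: _); ring.
have Ev i : E (v i) = (i%:R * (a + 1 - i%:R)) *: v i.-1.
  elim: i => [|i IH] /=; first by rewrite mul0r scale0r.
  rewrite act_ef IH Hv; case: i {IH} => [|i] /=.
    by rewrite mul0r scale0r linear0 add0r; congr (_ *: _); ring.
  rewrite linearZ /= -scalerDl; congr (_ *: _); ring.
pose X n := [seq v i | i <- iota 0 n].
have sizeX n : size (X n) = n by rewrite size_map size_iota.
have XS n : X n.+1 = rcons (X n) (v n).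
  by rewrite /X -[n.+1]addn1 iotaD map_cat /= cats1.
have freeS n : free (X n.+1) = (v n \notin <<X n>>%VS) && free (X n).
  by rewrite XS -free_cons; apply: perm_free; rewrite perm_rcons.
have [m nfree minm] : exists2 m, ~~ free (X m) &
    forall j, ~~ free (X j) -> (m <= j)%N.
  have ex : exists m, ~~ free (X m).
    exists 5%N; apply/negP => /eqP d; have := dimvS (subvf <<X 5%N>>%VS).
    by rewrite d sizeX dimV.
  by case: (ex_minnP ex) => m; exists m.
case: m nfree minm => [|n]; first by rewrite nil_free.
rewrite freeS negb_and negbK => + minm.
have freeX : free (X n) by apply/negPn/negP => /minm; rewrite ltnn.
rewrite freeX orbF => vn.
have inX i : (i < n)%N -> v i \in <<X n>>%VS.
  by move=> lti; apply/memv_span/map_f; rewrite mem_iota.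
have n_gt0 : (0 < n)%N.
  by case: (n) vn => //=; rewrite span_nil memv0 (negPf w0).
have Xfull : <<X n>>%VS = fullv.
  have [] // := irr <<X n>>%VS; last first.
    by move=> X0; move: (inX 0%N n_gt0); rewrite X0 memv0 /= (negPf w0).
  move=> x u; rewrite (sl2_decomp x) !lie_actDl !lie_actZl => uX.
  have stable (y : sl F 2) :
      (forall i, (i < n)%N -> lie_act y (v i) \in <<X n>>%VS) ->
      lie_act y u \in <<X n>>%VS.
    move=> yX; have := memv_img (linfun (lie_act y : V -> V)) uX.
    rewrite lfunE; apply: subvP; rewrite limg_span; apply/span_subvP => z.
    case/mapP => z' z'X ->; rewrite lfunE.
    have /allP/(_ _ z'X) : all (fun z => lie_act y z \in <<X n>>%VS) (X n).
      by rewrite all_map; apply/allP => i; rewrite mem_iota => /yX.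
    by [].
  rewrite !rpredD ?rpredZ ?stable // => i lti.
  - by rewrite Ev rpredZ ?inX // (leq_ltn_trans (leq_pred i)).
  - by rewrite Hv rpredZ ?inX.
  rewrite -[lie_act _ _]/(v i.+1).
  by move: lti; rewrite leq_eqVlt => /orP[/eqP ->|/inX].
have n4 : n = 4%N by rewrite -(sizeX n) -dimV -Xfull; apply/esym/eqP.
subst n.
have basisX : basis_of fullv [tuple v i | i < 4].
  have -> : [tuple v i | i < 4] = X 4%N :> seq V.
    by rewrite /X -val_enum_ord -map_comp.
  by rewrite /basis_of Xfull freeX eqxx.
have v4 : v 4%N = 0.
  pose c (i : 'I_4) := coord [tuple v i | i < 4] i (v 4%N).
  have vE : v 4%N = \sum_(i < 4) c i *: v i.
    rewrite {1}(coord_basis basisX (memvf (v 4%N))).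
    by apply: eq_bigr => i _; rewrite -tnth_nth tnth_mktuple.
  have sum0 : \sum_(i < 4) (c i * (8 - (2 * i)%:R)) *: v i = 0.
    have e4 : (a - 8) *: v 4%N = \sum_(i < 4) (c i * (a - (2 * i)%:R)) *: v i.
      rewrite -[8]/((2 * 4)%:R) -Hv vE linear_sum /=; apply: eq_bigr => i _.
      by rewrite linearZ /= Hv scalerA.
    transitivity (\sum_(i < 4) (c i * (a - (2 * i)%:R)) *: v i
                  - (a - 8) *: \sum_(i < 4) c i *: v i); last first.
      by rewrite -vE -e4 subrr.
    rewrite scaler_sumr -sumrB; apply: eq_bigr => i _.
    by rewrite scalerA -scalerBl; congr (_ *: _); ring.
  rewrite vE big1 // => i _.
  have /freeP/(_ (fun i => c i * (8 - (2 * i)%:R))) := basis_free basisX.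
  have sumX :
      \sum_(i < 4) (c i * (8 - (2 * i)%:R)) *: [tuple v i | i < 4]`_i = 0.
    rewrite -[RHS]sum0; apply: eq_bigr => j _.
    by rewrite -tnth_nth tnth_mktuple.
  move=> /(_ sumX i)/eqP.
  rewrite mulf_eq0 subr_eq0 eqr_nat => /orP[/eqP ->|]; first by rewrite scale0r.
  by rewrite -[8%N]/(2 * 4)%N eqn_pmul2l // gtn_eqF.
have a3 : a = 3.
  have := Ev 4%N; rewrite v4 linear0 /= => /esym/eqP.
  rewrite scaler_eq0 mulf_eq0 pnatr_eq0 /= => /orP[|v30].
    by rewrite subr_eq0 => /eqP a4; apply: (addIr 1); rewrite a4; ring.
  have := free_not0 freeX (map_f v (x := 3%N) _).
  by rewrite mem_iota v30 => /(_ isT).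
exists v; split=> // i; first by rewrite Hv a3.
by rewrite Ev a3; congr ((_ * (_ - _)) *: _); ring.
Qed.

End V3.

(** * The standard basis of the semidirect product *)

Section StandardBasis.
Variables (F : numClosedFieldType) (V : lieVectType (sl F 2)).
Local Notation g := (semidirect V : lieAlgType F).

Definition semidirect_basis (v : nat -> V) (i : nat) : g :=
  match i with
  | 0%N => (sl2e F, 0) | 1%N => (sl2h F, 0) | 2%N => (sl2f F, 0)
  | j.+3 => (0, v j)
  end.

Definition semidirect_coord (v : nat -> V) (i : nat) (x : g) : F :=
  match i with
  | 0%N => val x.1 0 1 | 1%N => val x.1 0 0 | 2%N => val x.1 1 0
  | j.+3 => coord [tuple v i | i < 4] (inord j) x.2
  end.

Lemma bracket_anti i j :
  bracket j i = (Z.opp (bracket i j).1, (bracket i j).2).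
Proof.
by rewrite /bracket; do 7?[case: i => [|i]]; do 7?[case: j => [|j]];
  rewrite /= ?nth_nil.
Qed.

Lemma lie_semidirect0 (x y z : sl F 2) n : lie x y = n *: z ->
  lie ((x, 0) : g) (y, 0) = n *: ((z, 0) : g).
Proof.
by move=> xy; congr pair; rewrite /= ?xy // !lie_act0r subr0 scaler0.
Qed.

Lemma lie_semidirectV (x : sl F 2) (u w : V) n : lie_act x u = n *: w ->
  lie ((x, 0) : g) (0, u) = n *: ((0, w) : g).
Proof.
move=> xu; congr pair => /=; last by rewrite xu lie_act0r subr0.
rewrite scaler0; have /eqP := lieDr x 0 0.
by rewrite addr0 -subr_eq0 opprD addNKr oppr_eq0 => /eqP.
Qed.

Lemma lie_semidirectVV (u w : V) : lie ((0, u) : g) (0, w) = 0.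
Proof.
congr pair => /=; first exact: liexx.
by rewrite !lie_act0l subrr.
Qed.

Lemma semidirect_standard_basis : is_V 3 V ->
  exists v, standard_basis (semidirect_basis v) (semidirect_coord v).
Proof.
move=> /V3_basis[v [basis_v v4 Hv Fv Ev]]; exists v.
have tnthv (k : 'I_4) : v k = [tuple v i | i < 4]`_k.
  by rewrite -tnth_nth tnth_mktuple.
split.
- by move=> [|[|[|j]]] a x y /=; rewrite ?mxE //; exact: linearP.
- move=> [|[|[|i]]] [|[|[|j]]] lti ltj; rewrite /= ?mxE ?linear0 //=;
    rewrite ?subr0 ?sub0r ?oppr0 //.
  rewrite -[in v j](@inordK 3 j) // tnthv coord_free;
    last exact: basis_free basis_v.
  by rewrite -val_eqE /= !inordK // eq_sym.
- move=> [x u]; rewrite !big_ord_recl big_ord0 addr0.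
  congr pair; rewrite /= !scaler0 ?addr0 ?add0r.
    by rewrite addrA; exact: sl2_decomp.
  have uE : u = \sum_(j < 4) coord [tuple v i | i < 4] (inord j) u *: v j.
    rewrite {1}(coord_basis basis_v (memvf u)); apply: eq_bigr => j _.
    by rewrite inord_val tnthv.
  by rewrite {1}uE !big_ord_recl big_ord0 addr0.
have lie_lt i j : (i < j)%N -> (j < 7)%N ->
    lie (semidirect_basis v i) (semidirect_basis v j) =
    Zr F (bracket i j).1 *: semidirect_basis v (bracket i j).2.
  case: i => [|[|[|i]]]; case: j => [|[|[|j]]] //.
  - by move=> _ _; apply: lie_semidirect0; rewrite lie_anti lie_he -scaleNr.
  - by move=> _ _; apply: lie_semidirect0; rewrite lie_ef scale1r.
  - move=> _; do 4?[case: j => [|j]] => // _; apply: lie_semidirectV;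
      rewrite Ev; congr (_ *: _);
      [rewrite -[RHS]/(0 : F)|rewrite -[RHS]/(3 : F)|rewrite -[RHS]/(4 : F)
      |rewrite -[RHS]/(3 : F)]; ring.
  - by move=> _ _; apply: lie_semidirect0; rewrite lie_hf.
  - move=> _; do 4?[case: j => [|j]] => // _; apply: lie_semidirectV;
      rewrite Hv; congr (_ *: _);
      [rewrite -[RHS]/(3 : F)|rewrite -[RHS]/(1 : F)|rewrite -[RHS]/(-1 : F)
      |rewrite -[RHS]/(-3 : F)]; ring.
  - move=> _; do 4?[case: j => [|j]] => // _; apply: lie_semidirectV;
      by rewrite Fv ?v4 ?scale0r ?scale1r.
  move=> _ _; rewrite lie_semidirectVV; symmetry.
  by do 4?[case: i => [|i]]; do 4?[case: j => [|j]];
    rewrite /bracket /= ?nth_nil scale0r.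
move=> i j lti ltj; case: (ltngtP i j) => [ij|ji|->].
- exact: lie_lt.
- rewrite lie_anti lie_lt // (bracket_anti i j).
  by rewrite -[Zr F _]/(Zr F (Z.opp (bracket i j).1)) ZrN scaleNr opprK.
rewrite liexx {lti} [X in Zr F X](_ : _ = 0%BZ) ?scale0r //.
by do 7?[case: j ltj => [|j] ltj].
Qed.

End StandardBasis.

Theorem proposition4p3 (R : realType) (V : lieVectType (sl R[i] 2))
    (V3 : is_V 3 V) (k : nat) :
  let g : lieAlgType R[i] := semidirect V in
  if k \in [:: 1; 3; 4; 6]%N
  then lmod_isomorphic (CE_cohomology (ad g) k) R[i]^o
  else forall c : CE_cohomology (ad g) k, c = 0.
Proof.
have [v basis_v] := semidirect_standard_basis V3.
exact: standard_cohomology basis_v k.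
Qed.
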